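(* Let $q=\min\{m,n\}$, $r\in\{1,\dots,q\}$, $Z\in\mathbb{R}^{n\times m}$ and $\gamma>0$. Let $g:\mathbb{R}^q\to\mathbb{R}_{\ge 0}$ be a symmetric gauge function, let $k:\mathbb{R}_{\ge 0}\to\mathbb{R}\cup\{\infty\}$ be a proper, closed, increasing convex function, and let $f_1:=k(\|\cdot\|_g)+\chi_{\mathrm{rank}(\cdot)\le r}$. Then for all $P\in\mathrm{svd}_r(Z)$ it holds that $$\mathrm{prox}_{\gamma k(\|\cdot\|_g)}(P)=\mathrm{prox}_{\gamma k(\|\cdot\|_{g,r*})}(P)\in\mathrm{prox}_{\gamma f_1}(Z).$$ Moreover, let $M^c:=\mathrm{prox}_{\gamma k(\|\cdot\|_{g,r*})}(Z)$. Then the following are equivalent: (i) $M^c=\mathrm{prox}_{\gamma f_1}(Z)$; (ii) $\mathrm{rank}(M^c)\le r$; (iii) $\sigma_{r+j}(Z-M^c)=\sigma_{r+j}(Z)$ for all $j\in\{1,\dots,q-r\}$; (iv) $\sigma_r(Z-M^c)\ge\sigma_{r+1}(Z)$.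
   Context: For $X\in\mathbb{R}^{n\times m}$, $\sigma_1(X)\ge\dots\ge\sigma_q(X)$ are its singular values counted with multiplicity, and $\langle X,Y\rangle=\mathrm{trace}(X^TY)$, $\|X\|_{\ell_2}=\sqrt{\langle X,X\rangle}$ (Frobenius norm). $\mathrm{svd}_r(X)$ is the set of all matrices $\sum_{i=1}^r\sigma_i(X)u_iv_i^T$, where $X=\sum_{i=1}^q\sigma_i(X)u_iv_i^T$ ranges over all singular value decompositions of $X$ (if $\sigma_r(X)\ne\sigma_{r+1}(X)$ this is a single matrix, and the set is identified with it). A symmetric gauge function $g:\mathbb{R}^q\to\mathbb{R}_{\ge0}$ is a norm with $g(|x|)=g(x)$ (entrywise absolute value) and $g(Px)=g(x)$ for all permutation matrices $P$ and all $x$. It defines the unitarily invariant norm $\|X\|_g:=g(\sigma_1(X),\dots,\sigma_q(X))$. Its dual norm is $\|Y\|_{g^D}:=\max_{\|X\|_g\le1}\langle Y,X\rangle=g^D(\sigma_1(Y),\dots,\sigma_q(Y))$, where $g^D$ is again a symmetric gauge function. Put $\|Y\|_{g^D,r}:=g^D(\sigma_1(Y),\dots,\sigma_r(Y),0,\dots,0)$; the low-rank inducing norm $\|\cdot\|_{g,r*}$ is the dual norm of $\|\cdot\|_{g^D,r}$ with respect to $\langle\cdot,\cdot\rangle$. A function $f$ with values in $\mathbb{R}\cup\{\infty\}$ is proper if it is finite somewhere, and closed if all its sublevel sets $\{X : f(X)\le\alpha\}$, $\alpha\in\mathbb{R}$, are closed. $k$ is increasing if $x\le y\Rightarrow k(x)\le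 k(y)$ and there exist $x,y$ with $k(x)<k(y)$. $\chi_{\mathrm{rank}(\cdot)\le r}(M)$ equals $0$ if $\mathrm{rank}(M)\le r$ and $\infty$ otherwise. The proximal mapping is $\mathrm{prox}_f(Z):=\operatorname{argmin}_{M\in\mathbb{R}^{n\times m}}\left[f(M)+\tfrac12\|M-Z\|_{\ell_2}^2\right]$, a set of minimizers; when it is a singleton it is identified with its element (so $M=\mathrm{prox}_f(Z)$ means that $M$ is the unique minimizer). *)

(* Defs.v *)
From HB Require Import structures.
From mathcomp Require Export all_boot all_order all_fingroup all_algebra.
From mathcomp Require Export all_classical all_reals all_analysis.
Export Order.TTheory GRing.Theory Num.Theory numFieldNormedType.Exports.

Set Implicit Arguments.
Unset Strict Implicit.
Unset Printing Implicit Defensive.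

Local Open Scope classical_set_scope.
Local Open Scope ring_scope.

Definition inner_mx (R : realType) (m n : nat) (X Y : 'M[R]_(n, m)) : R :=
  \tr (X^T *m Y).

Definition frob_norm (R : realType) (m n : nat) (X : 'M[R]_(n, m)) : R :=
  Num.sqrt (inner_mx X X).

(* The i-th columns of U and V are the singular vectors u_i and v_i. *)
Definition is_svd (R : realType) (m n : nat) (X : 'M[R]_(n, m))
    (U : 'M[R]_(n, minn m n)) (s : 'rV[R]_(minn m n))
    (V : 'M[R]_(m, minn m n)) : Prop :=
  [/\ U^T *m U = 1%:M,
      V^T *m V = 1%:M,
      (forall i, 0 <= s 0 i),
      (forall i j : 'I_(minn m n), (i <= j)%N -> s 0 j <= s 0 i) &
      X = \sum_(i < minn m n) s 0 i *: (col i U *m (col i V)^T)].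

(* Every X has a singular value decomposition and all of them share the same
   vector s, so the default value 0 is never used. *)
Definition singular_values (R : realType) (m n : nat) (X : 'M[R]_(n, m)) :
    'rV[R]_(minn m n) :=
  xget 0 [set s | exists U V, is_svd X U s V].

(* Indices start at 1, and sigma i X = 0 for i > min(m, n). *)
Definition sigma (R : realType) (m n : nat) (i : nat) (X : 'M[R]_(n, m)) : R :=
  oapp (singular_values X 0) 0 (insub i.-1).

Definition svd_r (R : realType) (m n r : nat) (X : 'M[R]_(n, m)) :
    set 'M[R]_(n, m) :=
  [set M | exists U s V, is_svd X U s V /\
     M = \sum_(i < minn m n | (i < r)%N) s 0 i *: (col i U *m (col i V)^T)].

Definition symmetric_gauge (R : realType) (q : nat) (g : 'rV[R]_q -> R) : Prop :=
  [/\ (forall x, 0 <= g x),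
      (forall x, g x = 0 -> x = 0),
      (forall (a : R) x, g (a *: x) = `|a| * g x),
      (forall x y, g (x + y) <= g x + g y) &
      (forall x, g (map_mx Num.norm x) = g x) /\
      (forall (p : 'S_q) x, g (col_perm p x) = g x)].

Definition gauge_norm (R : realType) (m n : nat) (g : 'rV[R]_(minn m n) -> R)
    (X : 'M[R]_(n, m)) : R :=
  g (singular_values X).

(* The supremum is a maximum when N is a norm. *)
Definition dual_norm (R : realType) (m n : nat) (N : 'M[R]_(n, m) -> R)
    (Y : 'M[R]_(n, m)) : R :=
  sup [set inner_mx Y X | X in [set X | N X <= 1]].

(* The symmetric gauge function g^D that represents the dual of gauge_norm g,
   i.e. dual_norm (gauge_norm g) Y = g^D (singular_values Y) for all Y: its
   value at y is that dual norm at the rectangular diagonal matrix with diagonal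
   y, whose singular values are the entries of |y| in decreasing order. *)
Definition gauge_dual (R : realType) (m n : nat) (g : 'rV[R]_(minn m n) -> R)
    (y : 'rV[R]_(minn m n)) : R :=
  dual_norm (gauge_norm g)
    (pid_mx (minn m n) *m diag_mx y *m pid_mx (minn m n) : 'M[R]_(n, m)).

Definition trunc_gauge_norm (R : realType) (m n : nat)
    (g : 'rV[R]_(minn m n) -> R) (r : nat) (Y : 'M[R]_(n, m)) : R :=
  g (\row_(i < minn m n) if (i < r)%N then singular_values Y 0 i else 0).

Definition low_rank_norm (R : realType) (m n : nat)
    (g : 'rV[R]_(minn m n) -> R) (r : nat) : 'M[R]_(n, m) -> R :=
  dual_norm (trunc_gauge_norm (gauge_dual g) r).

(* A function on the nonnegative reals with values in R and +oo is encoded as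
   k : R -> \bar R; the values k x for x < 0 are junk and never constrained. *)
Definition nneg_proper (R : realType) (k : R -> \bar R) : Prop :=
  (forall x, 0 <= x -> k x != -oo%E) /\
  (exists2 x, 0 <= x & k x \is a fin_num).

Definition nneg_closed (R : realType) (k : R -> \bar R) : Prop :=
  forall a : R, closed [set x : R | 0 <= x /\ (k x <= a%:E)%E].

Definition nneg_increasing (R : realType) (k : R -> \bar R) : Prop :=
  (forall x y, 0 <= x -> x <= y -> (k x <= k y)%E) /\
  (exists x y, [/\ 0 <= x, 0 <= y & (k x < k y)%E]).

Definition nneg_convex (R : realType) (k : R -> \bar R) : Prop :=
  forall x y t : R, 0 <= x -> 0 <= y -> 0 <= t -> t <= 1 ->
    (k (t * x + (1 - t) * y)%R <= t%:E * k x + (1 - t)%:E * k y)%E.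

Definition rank_indicator (R : realType) (m n r : nat) (M : 'M[R]_(n, m)) :
    \bar R :=
  if (\rank M <= r)%N then 0%E else +oo%E.

Definition prox (R : realType) (m n : nat) (f : 'M[R]_(n, m) -> \bar R)
    (Z : 'M[R]_(n, m)) : set 'M[R]_(n, m) :=
  [set M | forall N : 'M[R]_(n, m),
     (f M + (2^-1 * frob_norm (M - Z) ^+ 2)%:E <=
      f N + (2^-1 * frob_norm (N - Z) ^+ 2)%:E)%E].

(* Main.v *)
Require Import Defs.
From mathcomp.real_closed Require complex.
From mathcomp Require Import ring lra zify.

Set Implicit Arguments.
Unset Strict Implicit.
Unset Printing Implicit Defensive.

Local Open Scope classical_set_scope.
Local Open Scope ring_scope.

(** Why the theorem holds. Write [gn] for the unitarily invariant norm of the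
    gauge [g] and [h] for the low-rank inducing norm.

    Everything about matrices reduces to singular values through von Neumann's
    inequality [von_neumann]: the pairing of two matrices is at most the pairing
    of their singular values. It gives uniqueness of singular values, shows that
    [gn] and [h] depend on singular values only, and shows that aligning the
    singular vectors of a competitor with those of [Z] never increases its
    distance to [Z]. Existence of decompositions comes from a real eigenvector of
    [X^T X] and Householder reflections.

    The two norms compare as follows: [gn <= h] everywhere
    ([gauge_le_low_rank_norm], by duality, since truncating singular values
    enlarges the dual ball) and [gn = h] on matrices of rank at most [r]
    ([low_rank_norm_eq_gauge], by Hoelder). Thus the convex objective with [h]
    minorizes the rank-constrained one, and the two agree at rank at most [r].

    Let [N] be a seminorm that depends on singular values only, and [M] the
    proximal point of [Z] for the cost [k] composed with [N]. It exists and is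
    unique by strong convexity ([prox_exists], [prox_unique]). By uniqueness
    [M = U diag(x) V^T] for any singular vectors [U], [V] of [Z]
    ([prox_spectral]). Testing the first-order condition [prox_variational] with
    sign changes and swaps of [x] shows that [z - x], where [z] are the singular
    values of [Z], is nonnegative and decreasing ([prox_residual_sorted]): it is
    the vector of singular values of [Z - M].

    Applied to a truncation [P] of [Z], this bounds the rank of the proximal
    point by [r], and the comparison of the norms gives the first half of the
    theorem ([prox_truncation]).

    For the second half, let [x] be the singular values of [Mc]. The rank of [Mc]
    is at most [r] if and only if [x] vanishes beyond the first [r] entries,
    which says that [Z - Mc] and [Z] have the same singular values there. That
    this rank bound decides whether [Mc] solves the rank-constrained problem is
    the comparison of the objectives. The delicate step starts from the single
    inequality [sigma r.+1 Z <= sigma r (Z - Mc)]. Optimality makes [Z - Mc] and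
    [Mc] an equality case of Hoelder's inequality between [h] and its dual
    ([prox_holder_eq]), and that dual ignores all but the first [r] singular
    values. So the later singular values of [Z - Mc] must be as large as their
    order permits wherever [x] is positive, that is, equal to the [r]-th one; the
    inequality excludes this, so [x] vanishes there ([prox_tail_eq0]). *)

(** * The trace inner product *)

Lemma inner_mxE (R : realType) (m n : nat) (X Y : 'M[R]_(n, m)) :
  inner_mx X Y = \sum_i \sum_j X i j * Y i j.
Proof.
rewrite /inner_mx /mxtrace exchange_big /=; apply: eq_bigr => j _.
by rewrite mxE; apply: eq_bigr => i _; rewrite mxE.
Qed.

Lemma inner_mxC (R : realType) (m n : nat) (X Y : 'M[R]_(n, m)) :
  inner_mx X Y = inner_mx Y X.
Proof. by rewrite /inner_mx -mxtrace_tr trmx_mul trmxK. Qed.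

Lemma inner_mxDr (R : realType) (m n : nat) (X Y W : 'M[R]_(n, m)) :
  inner_mx X (Y + W) = inner_mx X Y + inner_mx X W.
Proof. by rewrite /inner_mx mulmxDr mxtraceD. Qed.

Lemma inner_mxZr (R : realType) (m n : nat) a (X Y : 'M[R]_(n, m)) :
  inner_mx X (a *: Y) = a * inner_mx X Y.
Proof. by rewrite /inner_mx -scalemxAr mxtraceZ. Qed.

Lemma inner_mxDl (R : realType) (m n : nat) (X Y W : 'M[R]_(n, m)) :
  inner_mx (Y + W) X = inner_mx Y X + inner_mx W X.
Proof. by rewrite inner_mxC inner_mxDr !(inner_mxC X). Qed.

Lemma inner_mxZl (R : realType) (m n : nat) a (X Y : 'M[R]_(n, m)) :
  inner_mx (a *: Y) X = a * inner_mx Y X.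
Proof. by rewrite inner_mxC inner_mxZr inner_mxC. Qed.

Lemma inner_mxNr (R : realType) (m n : nat) (X Y : 'M[R]_(n, m)) :
  inner_mx X (- Y) = - inner_mx X Y.
Proof. by rewrite -scaleN1r inner_mxZr mulN1r. Qed.

Lemma inner_mxNl (R : realType) (m n : nat) (X Y : 'M[R]_(n, m)) :
  inner_mx (- Y) X = - inner_mx Y X.
Proof. by rewrite inner_mxC inner_mxNr inner_mxC. Qed.

Definition inner_mxl :=
  (inner_mxDl, inner_mxDr, inner_mxNl, inner_mxNr, inner_mxZl, inner_mxZr).

Lemma inner_mx_ge0 (R : realType) (m n : nat) (X : 'M[R]_(n, m)) :
  0 <= inner_mx X X.
Proof.
rewrite inner_mxE; apply: sumr_ge0 => i _; apply: sumr_ge0 => j _.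
by rewrite -expr2 sqr_ge0.
Qed.

Lemma sqr_entry_le (R : realType) (m n : nat) (X : 'M[R]_(n, m)) i j :
  X i j ^+ 2 <= inner_mx X X.
Proof.
rewrite inner_mxE (bigD1 i) //= (bigD1 j) //= -expr2 -addrA lerDl.
apply: addr_ge0; first by apply: sumr_ge0 => ? _; rewrite -expr2 sqr_ge0.
by do 2!apply: sumr_ge0 => ? _; rewrite -expr2 sqr_ge0.
Qed.

Lemma inner_mx_eq0 (R : realType) (m n : nat) (X : 'M[R]_(n, m)) :
  inner_mx X X <= 0 -> X = 0.
Proof.
move=> h; apply/matrixP => i j; rewrite mxE; apply/eqP.
by rewrite -sqrf_eq0 eq_le sqr_ge0 andbT (le_trans (sqr_entry_le X i j)).
Qed.

Lemma sqr_frob_norm (R : realType) (m n : nat) (X : 'M[R]_(n, m)) :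
  frob_norm X ^+ 2 = inner_mx X X.
Proof. by rewrite /frob_norm sqr_sqrtr // inner_mx_ge0. Qed.

(** * Von Neumann's trace inequality *)

Definition dotr (R : realType) (q : nat) (x y : 'rV[R]_q) : R :=
  \sum_i x 0 i * y 0 i.

Definition sorted_nneg (R : realType) (q : nat) (s : 'rV[R]_q) : Prop :=
  (forall i, 0 <= s 0 i) /\ (forall i j : 'I_q, (i <= j)%N -> s 0 j <= s 0 i).

(** The matrix [U diag(x) V^T]. The entries of [x] may have any sign and any
    order, so that singular vectors can be kept fixed while [x] is perturbed. *)
Definition synth (R : realType) (m n q : nat) (U : 'M[R]_(n, q))
    (x : 'rV[R]_q) (V : 'M[R]_(m, q)) : 'M[R]_(n, m) :=
  U *m diag_mx x *m V^T.

Lemma synthE (R : realType) (m n q : nat) (U : 'M[R]_(n, q)) (x : 'rV[R]_q)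
    (V : 'M[R]_(m, q)) :
  synth U x V = \sum_i x 0 i *: (col i U *m (col i V)^T).
Proof.
apply/matrixP => a b; rewrite /synth mxE summxE; apply: eq_bigr => i _.
rewrite mul_mx_diag !mxE big_ord1 !mxE; ring.
Qed.

Lemma inner_synth (R : realType) (m n q : nat) (U U' : 'M[R]_(n, q))
    (x y : 'rV[R]_q) (V V' : 'M[R]_(m, q)) :
  inner_mx (synth U x V) (synth U' y V') =
  \sum_i \sum_j x 0 i * y 0 j * ((U^T *m U') i j * (V^T *m V') i j).
Proof.
rewrite /inner_mx /synth !trmx_mul tr_diag_mx trmxK.
rewrite (_ : V *m _ *m _ = V *m (diag_mx x *m (U^T *m U') *m diag_mx y *m V'^T));
  last by rewrite !mulmxA.
have -> : V^T *m V' = (V'^T *m V)^T by rewrite trmx_mul trmxK.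
rewrite mxtrace_mulC -(mulmxA _ (V'^T)) mul_mx_diag mul_diag_mx /mxtrace.
apply: eq_bigr => i _; rewrite mxE; apply: eq_bigr => j _; rewrite !mxE; ring.
Qed.

Lemma dotr_synth (R : realType) (m n q : nat) (U : 'M[R]_(n, q))
    (x y : 'rV[R]_q) (V : 'M[R]_(m, q)) :
  U^T *m U = 1%:M -> V^T *m V = 1%:M ->
  inner_mx (synth U x V) (synth U y V) = dotr x y.
Proof.
move=> hU hV; rewrite inner_synth hU hV; apply: eq_bigr => i _.
rewrite (bigD1 i) //= big1 ?addr0 => [|j /negbTE hj]; rewrite !mxE.
  by rewrite eqxx /= !mulr1.
by rewrite eq_sym hj mul0r mulr0.
Qed.

(** Bessel's inequality: the [i]-th row of [U^T U'] lists the coefficients of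
    the [i]-th column of [U], a unit vector, on the orthonormal columns of [U'].
    The residual [d] of that expansion has squared norm one minus this sum. *)
Lemma bessel (R : realType) (n q : nat) (U U' : 'M[R]_(n, q)) i :
  U^T *m U = 1%:M -> U'^T *m U' = 1%:M ->
  \sum_j (U^T *m U') i j ^+ 2 <= 1.
Proof.
move=> hU hU'.
set c := row i (U^T *m U').
set d := row i U^T - c *m U'^T.
have h : inner_mx d d = 1 - \sum_j (U^T *m U') i j ^+ 2.
  have e1 : row i U^T *m (row i U^T)^T = 1%:M.
    rewrite -row_mul.
    apply/matrixP => a b; rewrite !ord1 mxE /= [RHS]mxE /=.
    have := congr1 (fun M => fun_of_matrix M i i) hU; rewrite !mxE eqxx /= => <-.
    by apply: eq_bigr => k _; rewrite !mxE.
  have e2 : row i U^T *m (c *m U'^T)^T = c *m c^T.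
    by rewrite trmx_mul trmxK mulmxA -row_mul.
  have e3 : (c *m U'^T) *m (row i U^T)^T = c *m c^T.
    by rewrite -[LHS]trmxK trmx_mul trmxK e2 trmx_mul trmxK.
  have e4 : (c *m U'^T) *m (c *m U'^T)^T = c *m c^T.
    by rewrite trmx_mul trmxK mulmxA -(mulmxA c) hU' mulmx1.
  rewrite /inner_mx mxtrace_mulC /d linearB /= mulmxBr !mulmxBl e1 e2 e3 e4.
  rewrite subrr subr0 linearB /= mxtrace1 /mxtrace big_ord1 mxE.
  by congr (_ - _); apply: eq_bigr => j _; rewrite !mxE -expr2.
by rewrite -subr_ge0 -h inner_mx_ge0.
Qed.

(** By [a b <= (a^2 + b^2) / 2] a row sum is at most the mean of two Bessel
    sums. *)
Lemma sub_stochastic (R : realType) (m n q : nat) (U U' : 'M[R]_(n, q))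
    (V V' : 'M[R]_(m, q)) i :
  U^T *m U = 1%:M -> V^T *m V = 1%:M -> U'^T *m U' = 1%:M ->
  V'^T *m V' = 1%:M ->
  \sum_j `|(U^T *m U') i j * (V^T *m V') i j| <= 1.
Proof.
move=> hU hV hU' hV'.
apply: (@le_trans _ _ (\sum_j (2^-1 * (U^T *m U') i j ^+ 2 +
                               2^-1 * (V^T *m V') i j ^+ 2))).
  apply: ler_sum => j _; rewrite normrM -(real_normK (num_real ((U^T *m U') i j))).
  rewrite -(real_normK (num_real ((V^T *m V') i j))).
  set a := `|_|; set b := `|_|; have := sqr_ge0 (a - b); nra.
rewrite big_split /= -!mulr_sumr.
have := bessel i hU hU'; have := bessel i hV hV'; lra.
Qed.

(** The coefficients are the successive drops of [s], the last entry being
    followed by 0; the sum telescopes. *)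
Lemma layer_cake (R : realType) (q : nat) (s : 'rV[R]_q) :
  sorted_nneg s -> exists2 a : 'I_q -> R, (forall k, 0 <= a k) &
    forall i, s 0 i = \sum_k a k * (i <= k)%N%:R.
Proof.
move=> [s0 sle].
pose S (k : nat) := oapp (s 0) 0 (insub k : option 'I_q).
have SE (i : 'I_q) : S i = s 0 i by rewrite /S valK.
have Sq : S q = 0 by rewrite /S insubF ?ltnn.
exists (fun k : 'I_q => S k - S k.+1) => [k|i].
  rewrite subr_ge0 SE /S; case: insubP => [j _ /= hj|_] /=; last exact: s0.
  by apply: sle; rewrite hj.
rewrite -SE; have h : (i <= q)%N by apply: ltnW.
rewrite -(big_mkord xpredT (fun k : nat => (S k - S k.+1) * (i <= k)%N%:R)).
rewrite (big_cat_nat _ h) //= big_nat big1 => [|k /andP[_ ki]]; last first.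
  by rewrite leqNgt ki mulr0.
rewrite add0r big_nat (eq_bigr (fun k => S k - S k.+1)) => [|k /andP[ik _]].
  rewrite -big_nat (eq_bigr (fun k => - S k.+1 - - S k)) => [|k _].
    by rewrite (telescope_sumr (fun k => - S k)) // Sq oppr0 add0r opprK.
  by rewrite opprK addrC.
by rewrite ik mulr1.
Qed.

(** Abel summation: by [layer_cake], comparing sums weighted by [s] reduces to
    comparing initial sums. *)
Lemma ler_weighted_sum (R : realType) (q : nat) (s : 'rV[R]_q)
    (c c' : 'I_q -> R) :
  sorted_nneg s ->
  (forall k : 'I_q, \sum_(i < q) (i <= k)%N%:R * c i <=
                    \sum_(i < q) (i <= k)%N%:R * c' i) ->
  \sum_i s 0 i * c i <= \sum_i s 0 i * c' i.
Proof.
move=> /layer_cake[a a0 sE] h.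
have e (d : 'I_q -> R) :
    \sum_i s 0 i * d i = \sum_k a k * \sum_(i < q) (i <= k)%N%:R * d i.
  under [RHS]eq_bigr do rewrite big_distrr /=.
  rewrite exchange_big /=; apply: eq_bigr => i _.
  by rewrite sE big_distrl /=; apply: eq_bigr => k _; rewrite mulrA.
by rewrite !e; apply: ler_sum => k _; apply: ler_wpM2l.
Qed.

(** The entries of [Q] in the first [k + 1] rows and [l + 1] columns sum to at
    most [k + 1], the smaller number of lines; written with indicators, this is
    the case of [sub_stochastic_pairing] where [s] and [t] are indicators of
    initial segments. *)
Lemma sub_stochastic_corner (R : realType) (q : nat) (Q : 'I_q -> 'I_q -> R)
    (k l : 'I_q) :
  (forall i, \sum_j `|Q i j| <= 1) -> (k <= l)%N ->
  \sum_(i < q) (i <= k)%N%:R * \sum_(j < q) (j <= l)%N%:R * Q i j <=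
  \sum_(i < q) (i <= k)%N%:R * (i <= l)%N%:R :> R.
Proof.
move=> hQ kl; apply: ler_sum => i _.
case: (leqP i k) => ik; last by rewrite !mul0r.
rewrite !mul1r (leq_trans ik kl); apply: le_trans (hQ i).
apply: ler_sum => j _; case: (j <= l)%N; rewrite ?mul1r ?mul0r //.
exact: ler_norm.
Qed.

Lemma sub_stochastic_pairing (R : realType) (q : nat) (s t : 'rV[R]_q)
    (Q : 'I_q -> 'I_q -> R) :
  sorted_nneg s -> sorted_nneg t ->
  (forall i, \sum_j `|Q i j| <= 1) -> (forall j, \sum_i `|Q i j| <= 1) ->
  \sum_i \sum_j s 0 i * t 0 j * Q i j <= dotr s t.
Proof.
move=> hs ht hr hc.
have -> : \sum_i \sum_j s 0 i * t 0 j * Q i j =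
          \sum_i s 0 i * \sum_j t 0 j * Q i j.
  apply: eq_bigr => i _; rewrite big_distrr.
  by apply: eq_bigr => j _; rewrite /= mulrA.
apply: ler_weighted_sum => // k.
have -> : \sum_(i < q) (i <= k)%N%:R * \sum_j t 0 j * Q i j =
          \sum_j t 0 j * \sum_(i < q) (i <= k)%N%:R * Q i j.
  under [LHS]eq_bigr do rewrite big_distrr /=.
  rewrite exchange_big /=; apply: eq_bigr => j _; rewrite big_distrr.
  by apply: eq_bigr => i _ /=; rewrite mulrCA.
under [leRHS]eq_bigr do rewrite mulrC.
apply: ler_weighted_sum => // l.
case: (leqP k l) => kl; last first.
  exact: (@sub_stochastic_corner _ _ (fun j i => Q i j)) (ltnW kl).
under [leRHS]eq_bigr do rewrite mulrC.
have -> : \sum_(j < q) (j <= l)%N%:R * \sum_(i < q) (i <= k)%N%:R * Q i j =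
          \sum_(i < q) (i <= k)%N%:R * \sum_(j < q) (j <= l)%N%:R * Q i j.
  under [LHS]eq_bigr do rewrite big_distrr /=.
  rewrite exchange_big /=; apply: eq_bigr => j _; rewrite big_distrr.
  by apply: eq_bigr => i _ /=; rewrite mulrCA.
exact: sub_stochastic_corner.
Qed.

(** Von Neumann: the trace pairs [s] and [t] through the products of entries of
    [U^T U'] and [V^T V'], which form a sub-stochastic matrix. *)
Lemma von_neumann (R : realType) (m n q : nat) (U U' : 'M[R]_(n, q))
    (V V' : 'M[R]_(m, q)) (s t : 'rV[R]_q) :
  U^T *m U = 1%:M -> V^T *m V = 1%:M -> U'^T *m U' = 1%:M ->
  V'^T *m V' = 1%:M -> sorted_nneg s -> sorted_nneg t ->
  inner_mx (synth U s V) (synth U' t V') <= dotr s t.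
Proof.
move=> hU hV hU' hV' hs ht; rewrite inner_synth.
apply: sub_stochastic_pairing => // [i|j]; first exact: sub_stochastic.
have e (k : nat) (A B : 'M[R]_(k, q)) i : (A^T *m B) i j = (B^T *m A) j i.
  by rewrite -[A^T *m B]trmxK mxE trmx_mul trmxK.
under eq_bigr do rewrite e [X in `|_ * X|]e.
exact: sub_stochastic.
Qed.

(** * Singular value decompositions *)

(** Over the complex numbers the characteristic polynomial has a root. Symmetry
    forces the eigenvalue to be real, so the real and imaginary parts [a] and
    [b] of an eigenvector satisfy the real eigenvector equation, and one of them
    is nonzero. *)
Section RealEigenvector.
Import complex.

Lemma symmetric_eigenvector (R : realType) (n : nat) (S : 'M[R]_n.+1) :
  S^T = S -> exists (v : 'rV_n.+1) (a : R), v != 0 /\ v *m S = a *: v.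
Proof.
move=> hS.
pose Sc : 'M[R[i]]_n.+1 := map_mx (real_complex R) S.
have [lam hlam] : exists lam, root (char_poly Sc) lam.
  by apply: closed_rootP; rewrite size_char_poly.
move: hlam; rewrite -eigenvalue_root_char => /eigenvalueP[w hw w0].
pose a : 'rV[R]_n.+1 := \row_j complex.Re (w 0 j).
pose b : 'rV[R]_n.+1 := \row_j complex.Im (w 0 j).
have ReS (I : finType) (F : I -> R[i]) :
    complex.Re (\sum_i F i) = \sum_i complex.Re (F i).
  by apply: (big_morph (@complex.Re R)) => // -[? ?] [? ?].
have ImS (I : finType) (F : I -> R[i]) :
    complex.Im (\sum_i F i) = \sum_i complex.Im (F i).
  by apply: (big_morph (@complex.Im R)) => // -[? ?] [? ?].
have ha : a *m S = complex.Re lam *: a - complex.Im lam *: b.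
  apply/rowP => j.
  have := congr1 (fun M => complex.Re (fun_of_matrix M 0 j)) hw.
  rewrite !mxE ReS; case: lam {hw} (w 0 j) => x y [x' y'] /= <-.
  apply: eq_bigr => i _; rewrite !mxE; case: (w 0 i) => ? ? /=; ring.
have hb : b *m S = complex.Re lam *: b + complex.Im lam *: a.
  apply/rowP => j.
  have := congr1 (fun M => complex.Im (fun_of_matrix M 0 j)) hw.
  rewrite !mxE ImS; case: lam {hw ha} (w 0 j) => x y [x' y'] /= <-.
  apply: eq_bigr => i _; rewrite !mxE; case: (w 0 i) => ? ? /=; ring.
have hsym : inner_mx (a *m S) b = inner_mx a (b *m S).
  rewrite /inner_mx trmx_mul hS -mulmxA mxtrace_mulC -mulmxA.
  by rewrite mxtrace_mulC -mulmxA.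
have ab0 : inner_mx a a + inner_mx b b != 0.
  apply: contra w0 => /eqP h.
  have := inner_mx_ge0 a; have := inner_mx_ge0 b => hb0 ha0.
  have a0 : a = 0 by apply: inner_mx_eq0; lra.
  have b0 : b = 0 by apply: inner_mx_eq0; lra.
  apply/eqP/rowP => j; rewrite mxE.
  have := congr1 (fun M => fun_of_matrix M 0 j) a0.
  have := congr1 (fun M => fun_of_matrix M 0 j) b0.
  by rewrite !mxE; case: (w 0 j) => x y /= -> ->.
have im0 : complex.Im lam = 0.
  move: hsym; rewrite ha hb !inner_mxl => h.
  have : complex.Im lam * (inner_mx a a + inner_mx b b) = 0 by lra.
  by move/eqP; rewrite mulf_eq0 (negbTE ab0) orbF => /eqP.
move: ha hb; rewrite im0 !scale0r subr0 addr0 => ha hb.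
have [a0|a0] := eqVneq a 0; last by exists a, (complex.Re lam).
exists b, (complex.Re lam); split=> //.
apply: contra ab0 => /eqP ->; rewrite a0.
by rewrite /inner_mx !mulmx0 linear0 addr0.
Qed.
End RealEigenvector.

Lemma unit_scaling (R : realType) (n : nat) (v : 'cV[R]_n) : v != 0 ->
  exists2 a, a != 0 & (a *: v)^T *m (a *: v) = 1%:M.
Proof.
move=> v0; have h : 0 < inner_mx v v.
  by rewrite lt_neqAle inner_mx_ge0 andbT eq_sym; apply: contra v0 => /eqP h;
    apply/eqP/inner_mx_eq0; rewrite h.
exists (Num.sqrt (inner_mx v v))^-1; first by rewrite invr_neq0 // sqrtr_eq0 -ltNge.
rewrite [LHS]mx11_scalar -trace_mx11 -/(inner_mx _ _) !inner_mxl.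
by rewrite mulrA -invfM -expr2 sqr_sqrtr ?ltW // mulVf ?gt_eqF.
Qed.

Definition singular_pair (R : realType) (m n : nat) (X : 'M[R]_(n, m))
    (u : 'cV[R]_n) (s : R) (v : 'cV[R]_m) : Prop :=
  [/\ 0 <= s, u^T *m u = 1%:M, v^T *m v = 1%:M,
      X *m v = s *: u & X^T *m u = s *: v].

(** Take a unit eigenvector [v] of [X^T X], with eigenvalue [a >= 0]. If [a] is
    positive, [u] is the normalized [X v]; otherwise [X v = 0] and [u] has to be
    found in the left kernel of [X], which is where the shape of [X] matters. *)
Lemma singular_pair_exists_tall (R : realType) (m n : nat)
    (X : 'M[R]_(n.+1, m.+1)) :
  (m <= n)%N -> exists u s v, singular_pair X u s v.
Proof.
move=> mn.
have hS : (X^T *m X)^T = X^T *m X by rewrite trmx_mul trmxK.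
have [w [a [w0 hw]]] := symmetric_eigenvector hS.
have wT0 : w^T != 0 by rewrite trmx_eq0.
have [c c0] := unit_scaling wT0; set v := c *: w^T => hv.
have hXv : X^T *m (X *m v) = a *: v.
  rewrite mulmxA /v -scalemxAr -{1}hS -trmx_mul hw linearZ /=.
  by rewrite !scalerA mulrC.
have ha : inner_mx (X *m v) (X *m v) = a.
  by rewrite /inner_mx trmx_mul -mulmxA hXv -scalemxAr hv mxtraceZ mxtrace1 mulr1.
have a0 : 0 <= a by rewrite -ha inner_mx_ge0.
have [az|aN0] := eqVneq a 0.
  have Xv0 : X *m v = 0 by apply: inner_mx_eq0; rewrite ha az.
  (* a tall matrix with a nonzero kernel also has a nonzero left kernel *)
  have : kermx X != 0.
    rewrite kermx_eq0 /row_free; apply/eqP => rX.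
    have : (\rank X^T <= m)%N.
      rewrite leqNgt; apply/negP => h.
      have fX : row_free X^T.
        by rewrite /row_free eqn_leq rank_leq_row.
      have /(congr1 trmx) := Xv0; rewrite trmx_mul trmx0 -(mul0mx _ X^T).
      move/(row_free_inj fX)/(congr1 trmx); rewrite trmxK trmx0 => v0.
      by move: hv; rewrite v0 mulmx0 => /eqP; rewrite eq_sym oner_eq0.
    by rewrite mxrank_tr rX => h; have := leq_trans h mn; rewrite ltnn.
  case/rowV0Pn => y /sub_kermxP yX y0.
  have yT0 : y^T != 0 by rewrite trmx_eq0.
  have [d d0] := unit_scaling yT0; set u := d *: y^T => hu.
  exists u, 0, v; split=> //; rewrite !scale0r //.
  by rewrite /u -scalemxAr -trmx_mul yX trmx0 scaler0.
have s0 : 0 < Num.sqrt a by rewrite sqrtr_gt0 lt_neqAle eq_sym aN0.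
exists ((Num.sqrt a)^-1 *: (X *m v)), (Num.sqrt a), v; split=> //.
- rewrite [LHS]mx11_scalar -trace_mx11 -/(inner_mx _ _) !inner_mxl ha.
  by rewrite mulrA -invfM -expr2 sqr_sqrtr // mulVf.
- by rewrite scalerA divff ?scale1r // gt_eqF.
rewrite -scalemxAr hXv scalerA -{2}(sqr_sqrtr a0) expr2 mulrA mulVf ?mul1r //.
by rewrite gt_eqF.
Qed.

Lemma singular_pair_exists (R : realType) (m n : nat) (X : 'M[R]_(n.+1, m.+1)) :
  exists u s v, singular_pair X u s v.
Proof.
have [|/ltnW nm] := leqP m n; first exact: singular_pair_exists_tall.
have [u [s [v [s0 hu hv h1 h2]]]] := singular_pair_exists_tall X^T nm.
by exists v, s, u; split=> //; rewrite -[X]trmxK.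
Qed.

(** The reflection in the hyperplane orthogonal to [w = v - e], where [e] is the
    first basis vector, exchanges [e] and [v]. *)
Lemma householder (R : realType) (n : nat) (v : 'cV[R]_(1 + n)) :
  v^T *m v = 1%:M ->
  exists2 H : 'M[R]_(1 + n), H^T *m H = 1%:M & H *m delta_mx 0 0 = v.
Proof.
move=> hv; pose e : 'cV[R]_(1 + n) := delta_mx 0 0.
have he : e^T *m e = 1%:M.
  by rewrite /e trmx_delta mul_delta_mx; apply/matrixP => i j; rewrite !ord1 !mxE.
have [ve|vNe] := eqVneq v e; first by exists 1%:M; rewrite ?trmx1 mul1mx.
have inner1 (x y : 'cV[R]_(1 + n)) : x^T *m y = (inner_mx x y)%:M.
  by rewrite [LHS]mx11_scalar -trace_mx11.
have vv : inner_mx v v = 1 by rewrite /inner_mx hv mxtrace1.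
have ee : inner_mx e e = 1 by rewrite /inner_mx he mxtrace1.
pose w := v - e.
have ww : inner_mx w w = 2 - 2 * inner_mx v e.
  by rewrite /w !inner_mxl vv ee (inner_mxC e v); lra.
have w0 : inner_mx w w != 0.
  apply: contra vNe => /eqP h; rewrite -subr_eq0; apply/eqP/inner_mx_eq0.
  by rewrite -/w h.
pose c := 2 / inner_mx w w.
have hH : (1%:M - c *: (w *m w^T))^T = 1%:M - c *: (w *m w^T).
  by rewrite linearB linearZ /= trmx1 trmx_mul trmxK.
exists (1%:M - c *: (w *m w^T)).
  rewrite hH mulmxBl mul1mx mulmxBr mulmx1 -scalemxAl -scalemxAr.
  rewrite (_ : w *m w^T *m (w *m w^T) = inner_mx w w *: (w *m w^T)); last first.
    by rewrite mulmxA -(mulmxA w) inner1 mul_mx_scalar scalemxAl.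
  have cw : c * inner_mx w w = 2 by rewrite divfK.
  move: (w *m w^T) => W; rewrite !scalerA -mulrA cw.
  by apply/matrixP => i j; rewrite !mxE; ring.
rewrite -/e mulmxBl mul1mx -scalemxAl -mulmxA inner1 mul_mx_scalar scalerA.
have -> : c * inner_mx w e = - 1.
  have -> : inner_mx w e = inner_mx v e - 1 by rewrite /w !inner_mxl ee.
  rewrite /c; apply: (mulIf w0).
  by rewrite mulrAC divfK // ww; ring.
by rewrite scaleN1r opprK /w addrC subrK.
Qed.

Definition rdiag (R : realType) (m n : nat) (d : nat -> R) : 'M[R]_(n, m) :=
  \matrix_(i, j) (d i *+ (i == j :> nat)).

(** Induction on the size: rotating a singular pair [(u, v)] to the first basis
    vectors makes the first row and column of [X] vanish off the diagonal. *)
Lemma full_svd_exists (R : realType) (n m : nat) (X : 'M[R]_(n, m)) :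
  exists U V d, [/\ U^T *m U = 1%:M, V^T *m V = 1%:M,
    (forall i, 0 <= d i) & X = U *m rdiag m n d *m V^T].
Proof.
elim: n m X => [m X|n IHn [X|m X]].
- exists 1%:M, 1%:M, (fun=> 0); split; rewrite ?trmx1 ?mulmx1 //.
  by rewrite flatmx0 [RHS]flatmx0.
- exists 1%:M, 1%:M, (fun=> 0); split; rewrite ?trmx1 ?mulmx1 //.
  by rewrite thinmx0 [RHS]thinmx0.
have [u [s [v [s0 hu hv Xv Xu]]]] := singular_pair_exists X.
have [H hH He] := @householder _ n u hu.
have [K hK Ke] := @householder _ m v hv.
have hH' := mulmx1C hH; have hK' := mulmx1C hK.
pose A : 'M[R]_(1 + n, 1 + m) := H^T *m X *m K.
have A1 : A *m delta_mx 0 0 = s *: delta_mx 0 (0 : 'I_1).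
  rewrite /A -!mulmxA [K *m _]Ke [X *m v]Xv -[in RHS](mul1mx (delta_mx _ _)) -hH.
  by rewrite -mulmxA He -scalemxAr.
have A2 : A^T *m delta_mx 0 0 = s *: delta_mx 0 (0 : 'I_1).
  rewrite /A !trmx_mul trmxK -!mulmxA [H *m _]He [X^T *m u]Xu.
  by rewrite -[in RHS](mul1mx (delta_mx _ _)) -hK -mulmxA Ke -scalemxAr.
have XE : X = H *m A *m K^T.
  by rewrite /A !mulmxA hH' mul1mx -mulmxA hK' mulmx1.
clearbody A.
have [U [V [d [hU hV d0 hA]]]] := IHn _ (drsubmx A).
have AE : A = block_mx s%:M 0 0 (drsubmx A).
  rewrite -[LHS]submxK; congr block_mx.
  - rewrite [LHS]mx11_scalar; congr (_%:M).
    have /(congr1 (fun M => fun_of_matrix M 0 0)) := A1.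
    rewrite -colE !mxE eqxx mulr1 => <-.
    by congr (A _ _); apply: val_inj.
  - apply/rowP => j; have /(congr1 (fun M => fun_of_matrix M (rshift 1 j) 0)) := A2.
    rewrite -colE !mxE -[_ == 0]val_eqE /= mulr0 => <-.
    by congr (A _ _); apply: val_inj.
  - apply/colP => i; have /(congr1 (fun M => fun_of_matrix M (rshift 1 i) 0)) := A1.
    rewrite -colE !mxE -[_ == 0]val_eqE /= mulr0 => <-.
    by congr (A _ _); apply: val_inj.
pose HU : 'M[R]_(1 + n) := H *m block_mx 1%:M 0 0 U.
pose KV : 'M[R]_(1 + m) := K *m block_mx 1%:M 0 0 V.
exists HU, KV.
exists (fun i => if i is i'.+1 then d i' else s).
have block1 k (W : 'M[R]_k) : W^T *m W = 1%:M ->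
    (block_mx (1%:M : 'M[R]_1) 0 0 W)^T *m block_mx 1%:M 0 0 W = 1%:M.
  move=> hW; rewrite tr_block_mx mulmx_block !trmx0 trmx1 !mulmx0 !mul0mx.
  by rewrite mulmx1 hW !addr0 add0r -scalar_mx_block.
split.
- by rewrite /HU trmx_mul mulmxA -(mulmxA _ H^T) hH mulmx1 block1.
- by rewrite /KV trmx_mul mulmxA -(mulmxA _ K^T) hK mulmx1 block1.
- by case.
have -> : KV^T = (block_mx 1%:M 0 0 V)^T *m K^T by rewrite -trmx_mul.
rewrite XE /HU !mulmxA; congr (_ *m _); rewrite -!mulmxA; congr (_ *m _).
have -> : rdiag (1 + m) (1 + n) (fun i => if i is i'.+1 then d i' else s) =
          block_mx s%:M 0 0 (rdiag m n d).
  apply/matrixP => i j.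
  case: (split_ordP i) => i' ->; case: (split_ordP j) => j' ->; rewrite mxE /=.
  - by rewrite block_mxEul !ord1 !mxE.
  - by rewrite block_mxEur !ord1 !mxE.
  - by rewrite block_mxEdl !ord1 !mxE.
  - by rewrite block_mxEdr !mxE.
rewrite AE hA; suff : block_mx s%:M 0 0 (U *m rdiag m n d *m V^T) =
    block_mx (1%:M : 'M[R]_1) 0 0 U *m
    (block_mx s%:M 0 0 (rdiag m n d) *m (block_mx (1%:M : 'M[R]_1) 0 0 V)^T) by [].
rewrite tr_block_mx !mulmx_block !trmx0 trmx1 !mulmx0 !mul0mx.
by rewrite !(addr0, add0r, mulmx1, mul1mx, mulmx0) mulmxA.
Qed.

Lemma svd_unsorted (R : realType) (m n : nat) (X : 'M[R]_(n, m)) :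
  exists (U : 'M[R]_(n, minn m n)) (V : 'M[R]_(m, minn m n)) s,
    [/\ U^T *m U = 1%:M, V^T *m V = 1%:M & X = synth U s V].
Proof.
have [U [V [d [hU hV _ ->]]]] := full_svd_exists X.
pose q := minn m n.
have pid k : (q <= k)%N -> (pid_mx q : 'M[R]_(k, q))^T *m pid_mx q = 1%:M.
  by move=> qk; rewrite tr_pid_mx pid_mx_id // pid_mx_1.
exists (U *m pid_mx q), (V *m pid_mx q), (\row_i d i); split.
- by rewrite trmx_mul mulmxA -(mulmxA _ U^T) hU mulmx1 pid // geq_minr.
- by rewrite trmx_mul mulmxA -(mulmxA _ V^T) hV mulmx1 pid // geq_minl.
rewrite /synth trmx_mul !mulmxA; congr (_ *m _); rewrite -!mulmxA; congr (_ *m _).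
rewrite mulmxA mul_mx_diag; apply/matrixP => i j; rewrite !mxE.
have [ij|ij] := eqVneq (i : nat) j.
  have iq : (i < q)%N by rewrite /q ltn_min ltn_ord ij ltn_ord.
  rewrite (bigD1 (Ordinal iq)) //= big1 => [|k /eqP kN]; rewrite !mxE /=.
    by rewrite -ij eqxx iq /= addr0 mul1r mulr1.
  rewrite (_ : (i == k :> nat) = false) ?mul0r //; apply/negbTE/eqP => ik.
  by apply: kN; apply: val_inj.
rewrite big1 // => k _; rewrite !mxE.
have [ik|] := eqVneq (i : nat) k; last by rewrite !mul0r.
by rewrite -ik eq_sym (negbTE ij) mulr0.
Qed.

Definition normr_mx (R : realType) (q : nat) (x : 'rV[R]_q) : 'rV[R]_q :=
  map_mx Num.norm x.

Lemma sorting_perm (R : realType) (q : nat) (x : 'rV[R]_q) :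
  (forall i, 0 <= x 0 i) -> exists p : 'S_q, sorted_nneg (col_perm p x).
Proof.
move=> x0; pose t : q.-tuple R := [tuple x 0 i | i < q].
have /tuple_permP[p hp] : perm_eq (sort >=%R t) t by rewrite perm_sort.
exists p; split=> [i|i j ij]; rewrite !mxE //.
have e k : x 0 (p k) = nth 0 (sort >=%R t) k.
  by rewrite hp -tnth_nth !tnth_map !tnth_ord_tuple.
rewrite !e; apply: (sorted_leq_nth (leT := >=%R)) => //.
- by move=> a b c /= ab bc; apply: le_trans bc ab.
- by move=> a; apply: lexx.
- by apply: (sort_sorted (leT := >=%R)) => a b; apply: le_total.
- by rewrite inE size_sort size_tuple.
- by rewrite inE size_sort size_tuple.
Qed.

(** The signs of [x] are absorbed in the columns of [U], and the permutation
    in the columns of both [U] and [V]. *)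
Lemma synth_svd (R : realType) (m n : nat) (U : 'M[R]_(n, minn m n)) x
    (V : 'M[R]_(m, minn m n)) (p : 'S_(minn m n)) :
  U^T *m U = 1%:M -> V^T *m V = 1%:M -> sorted_nneg (col_perm p (normr_mx x)) ->
  exists U' V', is_svd (synth U x V) U' (col_perm p (normr_mx x)) V'.
Proof.
move=> hU hV; set q := minn m n in U V x p hU hV *; move=> [s0 sle].
pose sg : 'rV[R]_q := \row_i (-1) ^+ (x 0 i < 0)%R.
have hsg : diag_mx sg *m diag_mx sg = 1%:M.
  rewrite mul_diag_mx; apply/matrixP => i j; rewrite !mxE.
  case: eqVneq => [->|]; rewrite ?mulr1n ?mulr0n ?mulr0 //.
  by rewrite -expr2 sqrr_sign.
pose U' := U *m diag_mx sg.
have hU' : U'^T *m U' = 1%:M.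
  by rewrite /U' trmx_mul tr_diag_mx mulmxA -(mulmxA _ U^T) hU mulmx1.
have perm1 k (W : 'M[R]_(k, q)) : W^T *m W = 1%:M ->
    (col_perm p W)^T *m col_perm p W = 1%:M.
  move=> hW; rewrite tr_col_perm.
  apply/matrixP => i j; have := congr1 (fun M => fun_of_matrix M (p i) (p j)) hW.
  rewrite !mxE (inj_eq perm_inj) => <-; apply: eq_bigr => l _; rewrite !mxE //.
exists (col_perm p U'), (col_perm p V); split=> //; try exact: perm1.
rewrite synthE (reindex_inj (@perm_inj _ p)) /=; apply: eq_bigr => i _.
rewrite /normr_mx !mxE.
have -> : col i (col_perm p U') = (-1) ^+ (x 0 (p i) < 0)%R *: col (p i) U.
  by rewrite /U' mul_mx_diag; apply/colP => l; rewrite !mxE mulrC.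
have -> : col i (col_perm p V) = col (p i) V by apply/colP => l; rewrite !mxE.
by rewrite -scalemxAl scalerA [X in _ = X *: _]mulrC -numEsign.
Qed.

Lemma is_svdE (R : realType) (m n : nat) (X : 'M[R]_(n, m)) U s V :
  is_svd X U s V <->
  [/\ U^T *m U = 1%:M, V^T *m V = 1%:M, sorted_nneg s & X = synth U s V].
Proof.
split=> [[hU hV s0 sle XE]|[hU hV [s0 sle] XE]]; split=> //.
  by rewrite synthE.
by rewrite -synthE.
Qed.

(** Pairing [X] with [U diag(1,..,1,0,..,0) V^T] gives the initial sums of [s];
    by [von_neumann] they are at most those of [s']. By symmetry all initial sums
    agree, hence all entries. *)
Lemma svd_unique (R : realType) (m n : nat) (X : 'M[R]_(n, m)) U s V U' s' V' :
  is_svd X U s V -> is_svd X U' s' V' -> s = s'.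
Proof.
move=> /is_svdE[hU hV hs XE] /is_svdE[hU' hV' hs' XE'].
pose one (k : nat) : 'rV[R]_(minn m n) := \row_i (i < k)%N%:R.
have hone k : sorted_nneg (one k).
  split=> [i|i j ij]; rewrite !mxE ?ler0n // ler_nat.
  by case: (ltnP j k) => // jk; rewrite (leq_ltn_trans ij jk).
have le k : dotr s (one k) <= dotr s' (one k).
  by rewrite -(dotr_synth _ _ hU hV) -XE XE'; apply: von_neumann.
have ge k : dotr s' (one k) <= dotr s (one k).
  by rewrite -(dotr_synth _ _ hU' hV') -XE' XE; apply: von_neumann.
have eqk k : dotr s (one k) = dotr s' (one k).
  by apply/eqP; rewrite eq_le le ge.
have e (t : 'rV[R]_(minn m n)) i : t 0 i = dotr t (one i.+1) - dotr t (one i).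
  rewrite /dotr -sumrB (bigD1 i) //= !mxE ltnSn ltnn big1 => [|j ji].
    by rewrite mulr1 mulr0 subr0 addr0.
  by rewrite !mxE ltnS leq_eqVlt val_eqE (negbTE ji) subrr.
by apply/rowP => i; rewrite !e !eqk.
Qed.

Lemma svd_exists (R : realType) (m n : nat) (X : 'M[R]_(n, m)) :
  exists U V, is_svd X U (singular_values X) V.
Proof.
have [U [V [s [hU hV XE]]]] := svd_unsorted X.
have [|p hp] := @sorting_perm _ _ (normr_mx s); first by move=> i; rewrite mxE.
have [U' [V' h]] := synth_svd hU hV hp.
rewrite /singular_values; case: xgetP => [y _ //|/(_ (col_perm p (normr_mx s)))].
by case; exists U', V'; rewrite XE.
Qed.

Lemma singular_valuesE (R : realType) (m n : nat) (X : 'M[R]_(n, m)) U s V :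
  is_svd X U s V -> singular_values X = s.
Proof. by have [U' [V' h]] := svd_exists X => /(svd_unique h). Qed.

Lemma sorted_singular_values (R : realType) (m n : nat) (X : 'M[R]_(n, m)) :
  sorted_nneg (singular_values X).
Proof. by have [U [V /is_svdE[]]] := svd_exists X. Qed.

Lemma singular_values_synth (R : realType) (m n : nat)
    (U : 'M[R]_(n, minn m n)) s (V : 'M[R]_(m, minn m n)) :
  U^T *m U = 1%:M -> V^T *m V = 1%:M -> sorted_nneg s ->
  singular_values (synth U s V) = s.
Proof.
by move=> hU hV hs; apply: (@singular_valuesE _ _ _ _ U _ V); apply/is_svdE.
Qed.

Lemma inner_mx_le_singular_values (R : realType) (m n : nat)
    (X Y : 'M[R]_(n, m)) :
  inner_mx X Y <= dotr (singular_values X) (singular_values Y).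
Proof.
have [U [V /is_svdE[hU hV hs {1}->]]] := svd_exists X.
have [U' [V' /is_svdE[hU' hV' hs' {1}->]]] := svd_exists Y.
exact: von_neumann.
Qed.

Lemma rank_synth_le (R : realType) (m n q r : nat) (U : 'M[R]_(n, q))
    (s : 'rV[R]_q) (V : 'M[R]_(m, q)) :
  (forall i : 'I_q, (r <= i)%N -> s 0 i = 0) -> (\rank (synth U s V) <= r)%N.
Proof.
move=> h; apply: leq_trans (mxrankM_maxl _ _) _.
apply: leq_trans (mxrankM_maxr _ _) _.
have -> : diag_mx s = diag_mx s *m (pid_mx r : 'M[R]_q).
  rewrite mul_diag_mx; apply/matrixP => j k; rewrite !mxE.
  case: eqVneq => [->|jk]; last by rewrite val_eqE (negbTE jk) mulr0 mulr0n.
  by rewrite eqxx /=; case: ltnP => [|/h->]; rewrite ?mulr1 ?mul0rn ?mul0r.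
apply: leq_trans (mxrankM_maxr _ _) _.
rewrite (_ : pid_mx r = (pid_mx r : 'M[R]_(q, r)) *m (pid_mx r : 'M[R]_(r, q))).
  exact: mulmx_max_rank.
by rewrite mul_pid_mx !minnn.
Qed.

(** If [s_i] were nonzero for some [i >= r], the first [i + 1] entries of [s]
    would all be positive and inverting them would give [diag(s)] a left multiple
    of rank [i + 1]. *)
Lemma rank_synth (R : realType) (m n q r : nat) (U : 'M[R]_(n, q)) s
    (V : 'M[R]_(m, q)) :
  U^T *m U = 1%:M -> V^T *m V = 1%:M -> sorted_nneg s ->
  (\rank (synth U s V) <= r)%N <-> (forall i : 'I_q, (r <= i)%N -> s 0 i = 0).
Proof.
move=> hU hV [s0 sle].
have rE : \rank (synth U s V) = \rank (diag_mx s).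
  apply/eqP; rewrite eqn_leq; apply/andP; split.
    by apply: leq_trans (mxrankM_maxl _ _) _; apply: mxrankM_maxr.
  have {1}-> : diag_mx s = U^T *m synth U s V *m V.
    by rewrite /synth !mulmxA hU mul1mx -mulmxA hV mulmx1.
  by apply: leq_trans (mxrankM_maxl _ _) _; apply: mxrankM_maxr.
split; last exact: rank_synth_le.
rewrite rE => hr i ri.
apply/eqP; apply: contraT => si; exfalso.
pose a : 'rV[R]_q := \row_j (if (j <= i)%N then (s 0 j)^-1 else 0).
have : diag_mx a *m diag_mx s = pid_mx i.+1.
  rewrite mul_diag_mx; apply/matrixP => j k; rewrite !mxE ltnS.
  case: eqVneq => [<-|/negbTE jk]; last by rewrite mulr0n mulr0 val_eqE jk.
  rewrite eqxx /=.
  case: leqP => ji; rewrite ?mul0r // mulr1n mulVf // gt_eqF //.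
  by rewrite (lt_le_trans _ (sle _ _ ji)) // lt_neqAle eq_sym si s0.
move/(congr1 mxrank); rewrite rank_pid_mx ?ltn_ord // => h.
have := mxrankM_maxr (diag_mx a) (diag_mx s); rewrite h => h'.
by have := leq_trans h' hr; rewrite ltnNge ri.
Qed.

(** * Proximal mappings of increasing convex functions of a seminorm *)

Definition half_sqdist (R : realType) (m n : nat) (Z M : 'M[R]_(n, m)) : R :=
  2^-1 * inner_mx (M - Z) (M - Z).

Lemma half_sqdist_ge0 (R : realType) (m n : nat) (Z M : 'M[R]_(n, m)) :
  0 <= half_sqdist Z M.
Proof. by rewrite mulr_ge0 ?invr_ge0 ?inner_mx_ge0 ?ler0n. Qed.

(** Membership in a proximal mapping in terms of real numbers only: points of
    infinite value never compete, and a minimizer has finite value. *)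
Lemma prox_finP (R : realType) (m n : nat) (f : 'M[R]_(n, m) -> \bar R)
    (Z M : 'M[R]_(n, m)) :
  (forall X, f X != -oo%E) -> (exists X, f X \is a fin_num) ->
  prox f Z M <-> exists2 r, f M = r%:E & forall X s, f X = s%:E ->
    r + half_sqdist Z M <= s + half_sqdist Z X.
Proof.
move=> fNy [X0 fX0]; rewrite /prox /= /half_sqdist; split=> [h|[r fM h] X].
  have [r fM] : exists r, f M = r%:E.
    have := h X0; rewrite -(fineK fX0) -EFinD.
    by have := fNy M; case: (f M) => // r; exists r.
  exists r => // X s fX; have := h X.
  by rewrite fM fX -!EFinD lee_fin !sqr_frob_norm.
have := fNy X; rewrite fM; case fX: (f X) => [s| |] // _.
  by rewrite -!EFinD lee_fin !sqr_frob_norm; apply: h.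
by rewrite addye ?leey.
Qed.

Record seminorm (R : realType) (m n : nat) (N : 'M[R]_(n, m) -> R) : Prop := {
  seminormD : forall X Y, N (X + Y) <= N X + N Y;
  seminormZ : forall a X, N (a *: X) = `|a| * N X }.

Record convex_cost (R : realType) (k : R -> \bar R) : Prop := {
  cost_proper : nneg_proper k;
  cost_closed : nneg_closed k;
  cost_mono : forall x y, 0 <= x -> x <= y -> (k x <= k y)%E;
  cost_convex : nneg_convex k }.

Lemma seminorm0 (R : realType) (m n : nat) (N : 'M[R]_(n, m) -> R) :
  seminorm N -> N 0 = 0.
Proof. by move=> hN; rewrite -(scale0r 0) (seminormZ hN) normr0 mul0r. Qed.

Lemma seminorm_ge0 (R : realType) (m n : nat) (N : 'M[R]_(n, m) -> R) X :
  seminorm N -> 0 <= N X.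
Proof.
move=> hN; have := seminormD hN X (- 1 *: X).
rewrite scaleN1r subrr (seminorm0 hN) -scaleN1r (seminormZ hN) normrN normr1; lra.
Qed.

Lemma seminorm_sum (R : realType) (m n : nat) (N : 'M[R]_(n, m) -> R)
    (I : finType) (F : I -> 'M[R]_(n, m)) :
  seminorm N -> N (\sum_i F i) <= \sum_i N (F i).
Proof.
move=> hN; apply: (big_ind2 (fun X a => N X <= a)) => //.
  by rewrite (seminorm0 hN).
move=> X a Y b ha hb; apply: le_trans (seminormD hN _ _) _; exact: lerD.
Qed.

Lemma seminorm_lipschitz (R : realType) (m n : nat) (N : 'M[R]_(n, m) -> R) :
  seminorm N -> exists2 C, 0 <= C &
    forall (X Y : 'M[R]_(n, m)) e,
    (forall i j, `|X i j - Y i j| <= e) -> `|N X - N Y| <= e * C.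
Proof.
move=> hN; exists (\sum_i \sum_j N (delta_mx i j)) => [|X Y e h].
  by do 2!apply: sumr_ge0 => ? _; apply: seminorm_ge0.
have NB : N (X - Y) <= e * \sum_i \sum_j N (delta_mx i j).
  rewrite [X - Y]matrix_sum_delta mulr_sumr.
  apply: le_trans (seminorm_sum _ hN) _; apply: ler_sum => i _.
  rewrite mulr_sumr; apply: le_trans (seminorm_sum _ hN) _; apply: ler_sum => j _.
  rewrite (seminormZ hN) ler_wpM2r ?seminorm_ge0 //.
  by rewrite !mxE; apply: h.
have h1 := seminormD hN (X - Y) Y; rewrite subrK in h1.
have h2 := seminormD hN (Y - X) X; rewrite subrK in h2.
have h3 : N (Y - X) = N (X - Y).
  by rewrite -opprB -scaleN1r (seminormZ hN) normrN normr1 mul1r.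
rewrite ler_norml; apply/andP; split; lra.
Qed.

Lemma cost_fin0 (R : realType) (k : R -> \bar R) :
  convex_cost k -> k 0 \is a fin_num.
Proof.
case=> -[kNy [x x0 kx]] _ kmono _.
rewrite fin_numE kNy //=; apply/negP => /eqP k0.
by have := kmono 0 x (lexx _) x0; rewrite k0 -(fineK kx).
Qed.

(** The parallelogram law: the source of strong convexity, hence of both
    existence and uniqueness of minimizers. *)
Lemma half_sqdist_mid (R : realType) (m n : nat) (Z X Y : 'M[R]_(n, m)) :
  half_sqdist Z (2^-1 *: (X + Y)) =
  (half_sqdist Z X + half_sqdist Z Y) / 2 - inner_mx (X - Y) (X - Y) / 8.
Proof.
rewrite /half_sqdist !inner_mxl !(inner_mxC Y) !(inner_mxC Z X); lra.
Qed.

Lemma half_sqdistD (R : realType) (m n : nat) (Z M D : 'M[R]_(n, m)) t :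
  half_sqdist Z (M + t *: D) =
  half_sqdist Z M - t * inner_mx (Z - M) D + t * (t * (inner_mx D D / 2)).
Proof.
rewrite /half_sqdist !inner_mxl !(inner_mxC D) !(inner_mxC Z M); lra.
Qed.

Section ProxExists.
Context (R : realType) (m n : nat) (N : 'M[R]_(n, m) -> R) (k : R -> \bar R)
  (Z : 'M[R]_(n, m)).
Hypotheses (hN : seminorm N) (hk : convex_cost k).

Let kNy X : k (N X) != -oo%E.
Proof. by case: hk => -[+ _] _ _ _; apply; apply: seminorm_ge0. Qed.

Lemma prox_seminormP M : prox (fun X => k (N X)) Z M <->
  exists2 r, k (N M) = r%:E & forall X s, k (N X) = s%:E ->
    r + half_sqdist Z M <= s + half_sqdist Z X.
Proof.
apply: prox_finP => //; exists 0.
by rewrite (seminorm0 hN) cost_fin0.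
Qed.

Lemma cost_seminorm_mid X Y r s : k (N X) = r%:E -> k (N Y) = s%:E ->
  exists2 t, k (N (2^-1 *: (X + Y))) = t%:E & t <= (r + s) / 2.
Proof.
move=> kX kY.
have h : (k (N (2^-1 *: (X + Y))) <= ((r + s) / 2)%:E)%E.
  apply: (@le_trans _ _ (k (2^-1 * N X + (1 - 2^-1) * N Y))).
    apply: (cost_mono hk); first exact: seminorm_ge0.
    rewrite (seminormZ hN) ger0_norm ?invr_ge0 ?ler0n //.
    have := seminormD hN X Y; lra.
  have := @cost_convex _ _ hk (N X) (N Y) 2^-1 (seminorm_ge0 X hN)
    (seminorm_ge0 Y hN).
  have h0 : 0 <= 2^-1 :> R by lra.
  have h1 : 2^-1 <= 1 :> R by lra.
  move=> /(_ h0 h1)/le_trans; apply.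
  by rewrite kX kY -!EFinM -EFinD lee_fin; lra.
move: h (kNy (2^-1 *: (X + Y))); case: (k _) => // t; rewrite lee_fin => h _.
by exists t.
Qed.

Lemma prox_unique M M' :
  prox (fun X => k (N X)) Z M -> prox (fun X => k (N X)) Z M' -> M = M'.
Proof.
move=> /prox_seminormP[r kM hM] /prox_seminormP[s kM' hM'].
have [t kt tle] := cost_seminorm_mid kM kM'.
have := hM _ _ kt; have := hM' _ _ kt; rewrite half_sqdist_mid => h1 h2.
by apply/eqP; rewrite -subr_eq0; apply/eqP/inner_mx_eq0; lra.
Qed.

(** No compactness: for each [e > 0] choose [Me e] whose value exceeds the
    infimum by at most [e^2 / 4]. Strong convexity puts the entries of [Me e] and
    [Me e'] within [e + e'] of each other, so the suprema of [Me e i j - e]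
    define a limit [L] with entries within [e] of those of [Me e]. As [N] is
    Lipschitz and the sublevel sets of [k] are closed, [L] attains the infimum. *)
Lemma prox_exists : exists M, prox (fun X => k (N X)) Z M.
Proof.
pose A := [set a | exists X s, k (N X) = s%:E /\ a = s + half_sqdist Z X].
have k0E := fineK (cost_fin0 hk); set c0 := fine (k 0) in k0E.
have Alb : has_lbound A.
  exists c0 => _ [X [s [ks ->]]].
  have := cost_mono hk (lexx 0) (seminorm_ge0 X hN).
  rewrite -k0E ks lee_fin; have := half_sqdist_ge0 Z X; lra.
have A0 : A !=set0.
  by exists (c0 + half_sqdist Z 0), 0, c0; rewrite (seminorm0 hN) k0E.
have Ale X s : k (N X) = s%:E -> inf A <= s + half_sqdist Z X.
  by move=> kX; apply: ge_inf => //; exists X, s.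
have /choice[Me hMe] : forall e : R, exists X : 'M[R]_(n, m), 0 < e ->
    exists2 s, k (N X) = s%:E & s + half_sqdist Z X <= inf A + e ^+ 2 / 4.
  move=> e; have [e0|e0] := ltP 0 e; last by exists 0.
  have e4 : 0 < e ^+ 2 / 4 by rewrite divr_gt0 ?exprn_gt0.
  have [_ [X [s [kX ->]]] le] := inf_adherent e4 (conj A0 Alb).
  by exists X => _; exists s => //; apply: ltW.
have close e e' i j : 0 < e -> 0 < e' -> `|Me e i j - Me e' i j| <= e + e'.
  move=> e0 e0'; have [r kr rle] := hMe _ e0; have [s ks sle] := hMe _ e0'.
  have [t kt tle] := cost_seminorm_mid kr ks.
  have := Ale _ _ kt; rewrite half_sqdist_mid => It.
  have := sqr_entry_le (Me e - Me e') i j; rewrite !mxE => hij.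
  (* both squares are bounded: strong convexity gives |X - Y|^2 <= e^2 + e'^2 *)
  rewrite -(@ler_pXn2r _ 2) // ?nnegrE ?addr_ge0 ?ltW // real_normK ?num_real //.
  have : 0 < e * e' by apply: mulr_gt0.
  rewrite sqrrD; lra.
pose L : 'M[R]_(n, m) :=
  \matrix_(i, j) sup [set Me e i j - e | e in [set e | 0 < e]].
have hL e i j : 0 < e -> `|Me e i j - L i j| <= e.
  move=> e0; rewrite mxE.
  set S := [set _ | _ in _].
  have ub e' : 0 < e' -> ubound S (Me e' i j + e').
    move=> e0' _ [e'' /= e0'' <-].
    have := close _ _ i j e0' e0''; rewrite ler_norml; lra.
  have h1 : sup S <= Me e i j + e.
    by apply: ge_sup (ub _ e0); exists (Me e i j - e), e.
  have h2 : Me e i j - e <= sup S.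
    by apply: ub_le_sup; [exists (Me e i j + e); apply: ub|exists e].
  by rewrite ler_norml; lra.
clearbody L.
(* B bounds the drop of the squared distance from L to Me e, to first order *)
pose B := \sum_i \sum_j `|L i j - Z i j|.
have B0 : 0 <= B by do 2!apply: sumr_ge0 => ? _.
have qL e : 0 < e -> half_sqdist Z L - e * B <= half_sqdist Z (Me e).
  move=> e0; rewrite /half_sqdist !inner_mxE /B !mulr_sumr -sumrB.
  apply: ler_sum => i _; rewrite !mulr_sumr -sumrB; apply: ler_sum => j _.
  rewrite !mxE; have := hL _ i j e0; set x := Me e i j; set l := L i j.
  set z := Z i j => h.
  have : (z - l) * (x - l) <= e * `|l - z|.
    apply: le_trans (ler_norm _) _; rewrite normrM mulrC distrC [`|l - z|]distrC.
    rewrite -[`|l - x|]distrC; exact: ler_wpM2r.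
  have := sqr_ge0 (x - l); nra.
have [C C0 hC] := seminorm_lipschitz hN.
have kL : (k (N L) <= (inf A - half_sqdist Z L)%:E)%E.
  apply/lee_addgt0Pr => d d0; rewrite -EFinD.
  have [] // : [set x | 0 <= x /\ (k x <= (inf A - half_sqdist Z L + d)%:E)%E] (N L).
  apply: (cost_closed hk) => U /nbhs_ballP[eps /= eps0 epsU].
  pose e := Num.min 1 (Num.min (d / (1 + B)) (eps / (1 + C))).
  have e0 : 0 < e by rewrite !lt_min ltr01 !divr_gt0 //; lra.
  have e1 : e <= 1 by rewrite ge_min lexx.
  have ed : e * (1 + B) <= d.
    by rewrite -ler_pdivlMr; [rewrite !ge_min lexx !orbT|lra].
  have ee : e * (1 + C) <= eps.
    by rewrite -ler_pdivlMr; [rewrite !ge_min lexx !orbT|lra].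
  exists (N (Me e)); split.
    split; first exact: seminorm_ge0.
    have [r -> rle] := hMe _ e0; rewrite lee_fin; have := qL _ e0.
    have : e ^+ 2 <= e by rewrite expr2 ler_piMr // ltW.
    lra.
  apply: epsU; rewrite /ball /= distrC.
  apply: le_lt_trans (hC (Me e) L e _) _; last by lra.
  by move=> i j; apply: hL.
exists L; apply/prox_seminormP.
have [r kr] : exists r, k (N L) = r%:E.
  by move: kL (kNy L); case: (k _) => // r _ _; exists r.
exists r => // X s kX; apply: le_trans (Ale _ _ kX).
by move: kL; rewrite kr lee_fin; lra.
Qed.

(** [M] is the point nearest to [Z] in the convex set where [k (N X)] is at most
    [k (N M)]; the inequality is the first-order condition at [M] along the
    segment from [M] to [X]. *)
Lemma prox_variational M X :
  prox (fun X => k (N X)) Z M -> (k (N X) <= k (N M))%E ->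
  inner_mx (Z - M) (X - M) <= 0.
Proof.
move=> /prox_seminormP[r kM hM] XM.
set D := X - M; set p := inner_mx (Z - M) D.
have h t : 0 < t -> t <= 1 -> p <= t * (inner_mx D D / 2).
  move=> t0 t1.
  have kt : (k (N (M + t *: D)) <= r%:E)%E.
    have t1' : 0 <= 1 - t by rewrite subr_ge0.
    have -> : M + t *: D = t *: X + (1 - t) *: M.
      by rewrite /D scalerBr scalerBl scale1r addrCA addrA.
    apply: (@le_trans _ _ (k (t * N X + (1 - t) * N M))).
      apply: (cost_mono hk); first exact: seminorm_ge0.
      apply: le_trans (seminormD hN _ _) _.
      by rewrite !(seminormZ hN) !ger0_norm // ltW.
    have := @cost_convex _ _ hk (N X) (N M) t (seminorm_ge0 X hN)
      (seminorm_ge0 M hN) (ltW t0) t1.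
    move=> /le_trans; apply; rewrite kM.
    have [u kX] : exists u, k (N X) = u%:E.
      by move: XM (kNy X); rewrite kM; case: (k _) => // u _ _; exists u.
    move: XM; rewrite kX kM -!EFinM -EFinD !lee_fin => ur.
    have : t * u <= t * r by rewrite ler_wpM2l // ltW.
    lra.
  have [s ks] : exists s, k (N (M + t *: D)) = s%:E.
    by move: kt (kNy (M + t *: D)); case: (k _) => // s _ _; exists s.
  have sr : s <= r by rewrite -lee_fin -ks.
  have := hM _ _ ks; rewrite half_sqdistD -/p => hle.
  have : t * p <= t * (t * (inner_mx D D / 2)) by lra.
  by rewrite ler_pM2l.
have [D0|D0] := leP (inner_mx D D / 2) 0.
  by apply: le_trans (h 1 ltr01 (lexx 1)) _; rewrite mul1r.
rewrite leNgt; apply/negP => p0.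
pose t := Num.min 1 (p / (inner_mx D D)).
have D0' : 0 < inner_mx D D by lra.
have t0 : 0 < t by rewrite lt_min ltr01 divr_gt0.
have t1 : t <= 1 by rewrite ge_min lexx.
have : t * inner_mx D D <= p by rewrite -ler_pdivlMr // ge_min lexx orbT.
have := h _ t0 t1; lra.
Qed.
End ProxExists.

(** * Symmetric gauge functions and their duals *)

Lemma singular_valuesZ (R : realType) (m n : nat) a (X : 'M[R]_(n, m)) :
  singular_values (a *: X) = `|a| *: singular_values X.
Proof.
have [U [V /is_svdE[hU hV [s0 sle] XE]]] := svd_exists X.
apply: (@singular_valuesE _ _ _ _ ((-1) ^+ (a < 0)%R *: U) _ V); apply/is_svdE.
split=> //.
- rewrite [(_ *: _)^T]linearZ /= -scalemxAl -scalemxAr scalerA hU.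
  by rewrite -expr2 sqrr_sign scale1r.
- split=> [i|i j ij]; rewrite !mxE ?mulr_ge0 //.
  by apply: ler_wpM2l => //; apply: sle.
rewrite {1}XE /synth; have -> :
    diag_mx (`|a| *: singular_values X) = `|a| *: diag_mx (singular_values X).
  by rewrite linearZ.
rewrite -!scalemxAl -scalemxAr -!scalemxAl.
by rewrite scalerA -numEsign.
Qed.

Lemma inner_mx_singular_values (R : realType) (m n : nat) (X : 'M[R]_(n, m)) :
  inner_mx X X = dotr (singular_values X) (singular_values X).
Proof.
by have [U [V /is_svdE[hU hV hs {1 2}->]]] := svd_exists X; rewrite dotr_synth.
Qed.

Definition signflip (R : realType) (q : nat) (P : pred 'I_q) (x : 'rV[R]_q) :=
  \row_i (if P i then - x 0 i else x 0 i).

Definition mask (R : realType) (q : nat) (P : pred 'I_q) (x : 'rV[R]_q) :=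
  \row_i (if P i then x 0 i else 0).

Definition trunc_row (R : realType) (q r : nat) (x : 'rV[R]_q) : 'rV[R]_q :=
  mask (fun i : 'I_q => (i < r)%N) x.

Lemma dotr_mask (R : realType) (q : nat) (P : pred 'I_q) (x y : 'rV[R]_q) :
  dotr x (mask P y) = dotr (mask P x) y.
Proof.
by apply: eq_bigr => i _; rewrite !mxE; case: (P i); rewrite ?mulr0 ?mul0r.
Qed.

Lemma dotrC (R : realType) (q : nat) (x y : 'rV[R]_q) : dotr x y = dotr y x.
Proof. by apply: eq_bigr => i _; rewrite mulrC. Qed.

Lemma dotrZl (R : realType) (q : nat) a (x y : 'rV[R]_q) :
  dotr (a *: x) y = a * dotr x y.
Proof. by rewrite /dotr mulr_sumr; apply: eq_bigr => i _; rewrite mxE mulrA. Qed.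

Lemma dotrZr (R : realType) (q : nat) a (x y : 'rV[R]_q) :
  dotr x (a *: y) = a * dotr x y.
Proof. by rewrite dotrC dotrZl dotrC. Qed.

Lemma ltr_dotr (R : realType) (q : nat) (x y y' : 'rV[R]_q) (i : 'I_q) :
  (forall j, 0 <= x 0 j) -> (forall j, y 0 j <= y' 0 j) ->
  0 < x 0 i -> y 0 i < y' 0 i -> dotr y x < dotr y' x.
Proof.
move=> x0 yy' xi yi; rewrite /dotr [ltLHS](bigD1 i) //= [ltRHS](bigD1 i) //=.
apply: ltr_leD; first by rewrite ltr_pM2r.
by apply: ler_sum => j _; apply: ler_wpM2r.
Qed.

Lemma dotr_inner (R : realType) (q : nat) (x y : 'rV[R]_q) :
  dotr x y = inner_mx x y.
Proof. by rewrite inner_mxE big_ord1. Qed.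

Lemma dotr0l (R : realType) (q : nat) (y : 'rV[R]_q) : dotr 0 y = 0.
Proof. by rewrite dotr_inner /inner_mx trmx0 mul0mx linear0. Qed.

Lemma dotr0r (R : realType) (q : nat) (x : 'rV[R]_q) : dotr x 0 = 0.
Proof. by rewrite dotrC dotr0l. Qed.

(** The dual of [g] on vectors. [gauge_dualE] identifies it with the dual that
    is defined through matrices. *)
Definition vec_dual (R : realType) (q : nat) (g : 'rV[R]_q -> R)
    (y : 'rV[R]_q) : R :=
  sup [set dotr x y | x in [set x | g x <= 1]].

(** The indicator of [0, c] in the sense of convex analysis: its composition
    with a seminorm has the metric projection onto a ball as proximal mapping. *)
Definition interval_cost (R : realType) (c t : R) : \bar R :=
  if t <= c then 0%E else +oo%E.

Lemma interval_cost_convex (R : realType) (c : R) :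
  0 <= c -> convex_cost (interval_cost c).
Proof.
move=> c0; rewrite /interval_cost; split.
- split; first by move=> x _; case: ifP.
  by exists 0; rewrite // c0.
- move=> a; have [a0|a0] := leP 0 a.
    have -> : [set x : R | 0 <= x /\ ((if (x <= c)%R then 0 else +oo) <= a%:E)%E]
        = `[0, c]%classic.
      apply/seteqP; split=> x /=; rewrite in_itv /=.
        by case=> ->; case: (x <= c); rewrite // leye_eq.
      by move=> /andP[-> ->]; rewrite lee_fin.
    exact: itv_closed.
  have -> : [set x : R | 0 <= x /\ ((if (x <= c)%R then 0 else +oo) <= a%:E)%E]
      = set0.
    rewrite -subset0 => x [_]; case: ifP => _; last by rewrite leye_eq.
    by rewrite lee_fin leNgt a0.
  exact: closed0.
- move=> x y x0 xy; have [yc|] := leP y c; last by rewrite leey.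
  by rewrite (le_trans xy yc).
move=> x y t x0 y0 t0 t1.
have [xc|xc] := leP x c; have [yc|yc] := leP y c.
- rewrite !mule0 adde0; case: ifP => // /negP; case.
  have -> : c = t * c + (1 - t) * c by ring.
  by apply: lerD; apply: ler_wpM2l => //; rewrite subr_ge0.
- have [->|t1'] := eqVneq t 1.
    by rewrite mul1r subrr mul0r addr0 xc mul0e adde0 mule0.
  rewrite mule0 add0e gt0_muley ?leey // lte_fin subr_gt0.
  by rewrite lt_neqAle t1' t1.
- have [->|t0'] := eqVneq t 0.
    by rewrite mul0r subr0 mul1r add0r yc mule0 mul0e adde0.
  by rewrite mule0 adde0 gt0_muley ?leey // lte_fin lt_neqAle eq_sym t0' t0.
have [->|t0'] := eqVneq t 0.
  by rewrite mul0e add0e subr0 mul1e leey.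
rewrite gt0_muley ?lte_fin ?lt_neqAle 1?eq_sym ?t0' ?t0 // addye ?leey //.
by have [->|t1'] := eqVneq t 1; rewrite ?subrr ?mul0e // gt0_muley // lte_fin
  subr_gt0 lt_neqAle t1' t1.
Qed.

Section Gauge.
Context (R : realType) (q : nat) (g : 'rV[R]_q -> R).
Hypothesis hg : symmetric_gauge g.

Lemma gauge_seminorm : seminorm g.
Proof. by case: hg => _ _ gZ gD _; split. Qed.

Lemma gauge_ge0 x : 0 <= g x.
Proof. by case: hg => h _ _ _ _; apply: h. Qed.
Lemma gauge_eq0 x : g x = 0 -> x = 0.
Proof. by case: hg => _ h _ _ _; apply: h. Qed.
Lemma gauge0 : g 0 = 0. Proof. exact: seminorm0 gauge_seminorm. Qed.
Lemma gaugeZ a x : g (a *: x) = `|a| * g x.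
Proof. exact: seminormZ gauge_seminorm _ _. Qed.
Lemma gauge_normr x : g (normr_mx x) = g x.
Proof. by case: hg => _ _ _ _ [h1 h2]; rewrite ?h1 ?h2. Qed.
Lemma gauge_perm (p : 'S_q) x : g (col_perm p x) = g x.
Proof. by case: hg => _ _ _ _ [h1 h2]; rewrite ?h1 ?h2. Qed.

Lemma gauge_signflip P x : g (signflip P x) = g x.
Proof.
rewrite -[LHS]gauge_normr -[RHS]gauge_normr; congr g; apply/rowP => i.
by rewrite !mxE; case: (P i); rewrite ?normrN.
Qed.

(** Erasing entries of [x] averages [x] with its reflection in these entries. *)
Lemma gauge_mask P x : g (mask P x) <= g x.
Proof.
have -> : mask P x = 2^-1 *: (x + signflip (predC P) x).
  by apply/rowP => i; rewrite !mxE /=; case: (P i) => /=; field.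
rewrite gaugeZ ger0_norm ?invr_ge0 ?ler0n //.
have := seminormD gauge_seminorm x (signflip (predC P) x).
rewrite gauge_signflip; lra.
Qed.

Lemma gauge_unit_gt0 (i : 'I_q) : 0 < g (delta_mx 0 i).
Proof.
rewrite lt_neqAle gauge_ge0 andbT eq_sym; apply/negP => /eqP/gauge_eq0/rowP/(_ i).
by rewrite !mxE !eqxx => /eqP; rewrite oner_eq0.
Qed.

Lemma gauge_coord (x : 'rV[R]_q) i : `|x 0 i| * g (delta_mx 0 i) <= g x.
Proof.
rewrite -gaugeZ; have -> : x 0 i *: delta_mx 0 i = mask (pred1 i) x.
  apply/rowP => j; rewrite !mxE eqxx /= eq_sym.
  by case: eqVneq => [->|]; rewrite ?mulr1 ?mulr0.
exact: gauge_mask.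
Qed.

Lemma vec_dual_has_sup y : has_sup [set dotr x y | x in [set x | g x <= 1]].
Proof.
split; first by exists (dotr 0 y), 0; rewrite //= gauge0.
exists (\sum_i (g (delta_mx 0 i))^-1 * `|y 0 i|) => _ [x /= gx <-].
apply: ler_sum => i _; apply: le_trans (ler_norm _) _; rewrite normrM.
apply: ler_wpM2r => //; rewrite -[leRHS]mul1r ler_pdivlMr ?gauge_unit_gt0 //.
exact: le_trans (gauge_coord x i) gx.
Qed.

Lemma vec_dual_ge x y : g x <= 1 -> dotr x y <= vec_dual g y.
Proof.
move=> gx; apply: ub_le_sup; first by have [] := vec_dual_has_sup y.
by exists x.
Qed.

Lemma vec_dual_le y c :
  (forall x, g x <= 1 -> dotr x y <= c) -> vec_dual g y <= c.
Proof.
move=> h; apply: ge_sup; first by have [] := vec_dual_has_sup y.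
by move=> _ [x /= gx <-]; apply: h.
Qed.

Lemma vec_dual_ge0 y : 0 <= vec_dual g y.
Proof.
by rewrite -(dotr0l y); apply: vec_dual_ge; rewrite gauge0.
Qed.

Lemma vec_dualZ_le a y : 0 <= a -> vec_dual g (a *: y) <= a * vec_dual g y.
Proof.
move=> a0; apply: vec_dual_le => x gx; rewrite dotrZr.
by apply: ler_wpM2l => //; apply: vec_dual_ge.
Qed.

(** Hoelder's inequality for a dual pair of gauges. *)
Lemma holder x y : dotr x y <= g x * vec_dual g y.
Proof.
have [/gauge_eq0 ->|gx] := eqVneq (g x) 0.
  by rewrite gauge0 mul0r dotr0l.
have gx0 : 0 < g x by rewrite lt_neqAle eq_sym gx gauge_ge0.
rewrite mulrC -ler_pdivrMr // mulrC -dotrZl; apply: vec_dual_ge.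
by rewrite gaugeZ normfV ger0_norm ?gauge_ge0 // mulVf.
Qed.

Lemma vec_dual_mask P y : vec_dual g (mask P y) <= vec_dual g y.
Proof.
apply: vec_dual_le => x gx; rewrite dotr_mask; apply: vec_dual_ge.
exact: le_trans (gauge_mask P x) gx.
Qed.

(** Moving the permutation and the signs from one factor to the other does not
    change the gauge. *)
Lemma gauge_transport (p : 'S_q) (x y : 'rV[R]_q) :
  exists2 x', g x' = g x & dotr x (col_perm p (normr_mx y)) = dotr x' y.
Proof.
exists (signflip (fun i => y 0 i < 0) (col_perm p^-1 x)).
  by rewrite gauge_signflip gauge_perm.
rewrite /dotr (reindex_inj (@perm_inj _ p^-1)) /=; apply: eq_bigr => i _.
rewrite !mxE permKV; case: (ltP (y 0 i) 0) => yi; last by rewrite ger0_norm.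
by rewrite ltr0_norm // mulrN mulNr.
Qed.

Lemma vec_dual_sorting (p : 'S_q) y :
  vec_dual g (col_perm p (normr_mx y)) <= vec_dual g y.
Proof.
apply: vec_dual_le => x gx; have [x' gx' ->] := gauge_transport p x y.
by apply: vec_dual_ge; rewrite gx'.
Qed.

(** The bipolar theorem, stated without attainment. Let [M] be the projection of
    [x] onto the ball [g X <= c]. The normal [Y = x - M] is maximal on that ball
    at [M], with value [d], so its dual gauge is at most [d / c]; and [x] lies
    beyond the supporting hyperplane at [M]. Rescale [Y] by [c / d]. *)
Lemma gauge_bidual x c : c < g x -> exists2 y, vec_dual g y <= 1 & c <= dotr x y.
Proof.
move=> cx; have [c0|c0] := leP c 0.
  exists 0; last by rewrite dotr0r.
  by apply: vec_dual_le => x' _; rewrite dotr0r ler01.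
have gS := gauge_seminorm; have kc := interval_cost_convex (ltW c0).
have [M hM] := prox_exists x gS kc.
have gM : g M <= c.
  have [t + _] := (prox_seminormP x gS kc M).1 hM.
  by rewrite /interval_cost; case: ifP.
have var X : g X <= c -> inner_mx (x - M) X <= inner_mx (x - M) M.
  move=> gX; rewrite -subr_le0 -inner_mxNr -inner_mxDr.
  by apply: (prox_variational gS kc hM); rewrite /interval_cost gX gM.
set Y := x - M in var *.
have Y0 : 0 < inner_mx Y Y.
  rewrite lt_neqAle inner_mx_ge0 andbT; apply/negP => /eqP h.
  have /eqP : Y = 0 by apply: inner_mx_eq0; rewrite -h.
  by rewrite subr_eq0 => /eqP xM; move: cx; rewrite xM ltNge gM.
set d := inner_mx Y M in var *.
have gY0 : 0 < g Y.
  rewrite lt_neqAle gauge_ge0 andbT; apply/negP => /eqP h.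
  by move: Y0; rewrite (gauge_eq0 (esym h)) /inner_mx mulmx0 linear0 ltxx.
have d0 : 0 < d.
  apply: lt_le_trans (var ((c / g Y) *: Y) _).
    by rewrite inner_mxZr mulr_gt0 // divr_gt0.
  by rewrite gaugeZ ger0_norm ?divfK ?gt_eqF // divr_ge0 ?ltW.
exists ((c / d) *: Y).
  apply: vec_dual_le => x' gx'; rewrite dotrZr mulrAC ler_pdivrMr // mul1r.
  rewrite -dotrZl dotrC dotr_inner; apply: var.
  by rewrite gaugeZ gtr0_norm // ger_pMr.
rewrite dotrZr dotrC dotr_inner mulrAC ler_pdivlMr // ler_pM2l //.
have -> : x = Y + M by rewrite subrK.
by rewrite inner_mxDr -/d lerDr ltW.
Qed.
End Gauge.

(** * Low-rank inducing norms *)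

Section LowRankNorm.
Context (R : realType) (m n : nat) (g : 'rV[R]_(minn m n) -> R).
Hypothesis hg : symmetric_gauge g.
Local Notation q := (minn m n).

Lemma gauge_singular_values_synth (U : 'M[R]_(n, q)) x (V : 'M[R]_(m, q)) :
  U^T *m U = 1%:M -> V^T *m V = 1%:M -> g (singular_values (synth U x V)) = g x.
Proof.
move=> hU hV; have [|p hp] := @sorting_perm _ _ (normr_mx x).
  by move=> i; rewrite mxE.
have [U' [V' /singular_valuesE ->]] := synth_svd hU hV hp.
by rewrite gauge_perm // gauge_normr.
Qed.

(** Von Neumann's inequality bounds the pairing of a diagonal matrix with any
    [X] by a pairing of vectors, and diagonal matrices attain all of these. *)
Lemma gauge_dualE : gauge_dual (m := m) (n := n) g = vec_dual g.
Proof.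
apply/funext => y.
have hU : (pid_mx q : 'M[R]_(n, q))^T *m pid_mx q = 1%:M.
  by rewrite tr_pid_mx pid_mx_id ?geq_minr // pid_mx_1.
have hV : (pid_mx q : 'M[R]_(m, q))^T *m pid_mx q = 1%:M.
  by rewrite tr_pid_mx pid_mx_id ?geq_minl // pid_mx_1.
have DE x : pid_mx q *m diag_mx x *m pid_mx q =
    synth (pid_mx q : 'M[R]_(n, q)) x (pid_mx q : 'M[R]_(m, q)).
  by rewrite /synth tr_pid_mx.
rewrite /gauge_dual /dual_norm DE.
set S := [set _ | _ in _].
have Sub : ubound S (vec_dual g y).
  move=> _ [X /= gX <-]; apply: le_trans (inner_mx_le_singular_values _ _) _.
  have [|p hp] := @sorting_perm _ _ (normr_mx y); first by move=> i; rewrite mxE.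
  have [U' [V' /singular_valuesE ->]] := synth_svd hU hV hp.
  have [x' gx' e] := gauge_transport hg p (singular_values X) y.
  by rewrite dotrC e; apply: vec_dual_ge => //; rewrite gx'.
have S0 x : g x <= 1 -> S (dotr x y).
  move=> gx; exists (synth (pid_mx q : 'M[R]_(n, q)) x (pid_mx q : 'M[R]_(m, q))).
    by rewrite /= /gauge_norm gauge_singular_values_synth.
  by rewrite dotr_synth // dotrC.
apply/eqP; rewrite eq_le; apply/andP; split.
  by apply: ge_sup => //; exists (dotr 0 y); apply: S0; rewrite gauge0.
apply: vec_dual_le => // x gx; apply: ub_le_sup; last exact: S0.
by exists (vec_dual g y).
Qed.

Variable r : nat.
Hypothesis hr : (1 <= r <= q)%N.

Local Notation T := (trunc_gauge_norm (gauge_dual (m := m) (n := n) g) r).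
Local Notation h := (low_rank_norm (m := m) (n := n) g r).

Lemma trunc_gauge_normE (W : 'M[R]_(n, m)) :
  T W = vec_dual g (trunc_row r (singular_values W)).
Proof. by rewrite /trunc_gauge_norm gauge_dualE. Qed.

Let i0 : 'I_q := Ordinal (leq_trans (andP hr).1 (andP hr).2).

(** As [r >= 1], the truncated dual norm sees the largest singular value. This
    makes its unit ball bounded, so that the supremum in the low-rank inducing
    norm is meaningful. *)
Lemma singular_value_le_trunc (W : 'M[R]_(n, m)) i :
  singular_values W 0 i <= g (delta_mx 0 i0) * T W.
Proof.
have [s0 sle] := sorted_singular_values W.
apply: le_trans (sle i0 i (leq0n _)) _; rewrite trunc_gauge_normE.
apply: le_trans (holder hg _ _); rewrite /dotr (bigD1 i0) //= big1 => [|j ji].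
  by rewrite !mxE !eqxx /= mul1r addr0; case/andP: hr => ->.
by rewrite !mxE eqxx /= (negbTE ji) mul0r.
Qed.

Lemma low_rank_norm_has_sup (X : 'M[R]_(n, m)) :
  has_sup [set inner_mx X W | W in [set W | T W <= 1]].
Proof.
split.
  exists (inner_mx X 0), 0 => //=; rewrite trunc_gauge_normE.
  rewrite -(scale0r 0) singular_valuesZ normr0 scale0r.
  have -> : trunc_row r (0 : 'rV[R]_q) = 0 by apply/rowP => i; rewrite !mxE if_same.
  by apply: vec_dual_le => // x _; rewrite dotr0r ler01.
exists (\sum_i singular_values X 0 i * g (delta_mx 0 i0)) => _ [W /= TW <-].
apply: le_trans (inner_mx_le_singular_values _ _) _; apply: ler_sum => i _.
have [s0 _] := sorted_singular_values X; apply: ler_wpM2l => //.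
apply: le_trans (singular_value_le_trunc W i) _.
by rewrite ger_pMr // gauge_unit_gt0.
Qed.

Lemma low_rank_norm_ge (X W : 'M[R]_(n, m)) : T W <= 1 -> inner_mx X W <= h X.
Proof.
move=> TW; apply: ub_le_sup; first by have [] := low_rank_norm_has_sup X.
by exists W.
Qed.

Lemma low_rank_norm_le (X : 'M[R]_(n, m)) c :
  (forall W, T W <= 1 -> inner_mx X W <= c) -> h X <= c.
Proof.
move=> H; apply: ge_sup; first by have [] := low_rank_norm_has_sup X.
by move=> _ [W /= TW <-]; apply: H.
Qed.

Lemma trunc_gauge_norm_ge0 (W : 'M[R]_(n, m)) : 0 <= T W.
Proof. by rewrite trunc_gauge_normE vec_dual_ge0. Qed.

Lemma trunc_gauge_normZ_le a (W : 'M[R]_(n, m)) : T (a *: W) <= `|a| * T W.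
Proof.
rewrite !trunc_gauge_normE singular_valuesZ.
have -> : trunc_row r (`|a| *: singular_values W) =
          `|a| *: trunc_row r (singular_values W).
  by apply/rowP => i; rewrite !mxE; case: ifP; rewrite ?mulr0.
exact: vec_dualZ_le.
Qed.

Lemma low_rank_norm_holder (X W : 'M[R]_(n, m)) : inner_mx X W <= h X * T W.
Proof.
have [T0|TN0] := eqVneq (T W) 0.
  rewrite T0 mulr0; apply: le_trans (inner_mx_le_singular_values _ _) _.
  apply: sumr_le0 => i _; have [s0 _] := sorted_singular_values X.
  rewrite mulr_ge0_le0 // (le_trans (singular_value_le_trunc W i)) //.
  by rewrite T0 mulr0.
have Tgt0 : 0 < T W by rewrite lt_neqAle eq_sym TN0 trunc_gauge_norm_ge0.
rewrite -ler_pdivrMr // mulrC -inner_mxZr; apply: low_rank_norm_ge.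
apply: le_trans (trunc_gauge_normZ_le _ _) _.
by rewrite normfV gtr0_norm // mulVf.
Qed.

(** Given [W], replace its singular vectors by those of [B]: by [von_neumann]
    the pairing does not decrease, while the constraint on [W] is unaffected. *)
Lemma low_rank_norm_spectral (X Y : 'M[R]_(n, m)) :
  singular_values X = singular_values Y -> h X = h Y.
Proof.
suff le (A B : 'M[R]_(n, m)) : singular_values A = singular_values B -> h A <= h B.
  by move=> e; apply/eqP; rewrite eq_le !le.
move=> e; apply: low_rank_norm_le => W TW.
apply: le_trans (inner_mx_le_singular_values _ _) _; rewrite e.
have [U [V /is_svdE[hU hV hs BE]]] := svd_exists B.
rewrite -(dotr_synth _ _ hU hV) -BE; apply: low_rank_norm_ge.
rewrite trunc_gauge_normE singular_values_synth //; last exact: sorted_singular_values.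
by rewrite -trunc_gauge_normE.
Qed.

Lemma low_rank_norm_seminorm : seminorm h.
Proof.
have Zle a (X : 'M[R]_(n, m)) : h (a *: X) <= `|a| * h X.
  apply: low_rank_norm_le => W TW; rewrite inner_mxZl.
  apply: le_trans (ler_norm _) _; rewrite normrM; apply: ler_wpM2l => //.
  rewrite ler_norml low_rank_norm_ge // andbT lerNl -inner_mxNr.
  apply: low_rank_norm_ge; apply: le_trans TW.
  by rewrite -scaleN1r (le_trans (trunc_gauge_normZ_le _ _)) // normrN1 mul1r.
split=> [X Y|a X].
  apply: low_rank_norm_le => W TW; rewrite inner_mxDl.
  by apply: lerD; apply: low_rank_norm_ge.
apply/eqP; rewrite eq_le Zle /=.
have [->|a0] := eqVneq a 0.
  rewrite normr0 mul0r scale0r -(_ : inner_mx 0 (0 : 'M[R]_(n, m)) = 0).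
    apply: low_rank_norm_ge; have := trunc_gauge_normZ_le 0 (0 : 'M[R]_(n, m)).
    by rewrite scale0r normr0 mul0r => /le_trans; apply.
  by rewrite /inner_mx mulmx0 linear0.
have := Zle a^-1 (a *: X); rewrite scalerA mulVf // scale1r normfV.
by rewrite mulrC ler_pdivlMr ?normr_gt0 // mulrC.
Qed.

(** For rank at most [r] only the first [r] singular values of [W] contribute to
    von Neumann's bound, and [holder] applies to them. *)
Lemma low_rank_norm_le_gauge (X : 'M[R]_(n, m)) :
  (\rank X <= r)%N -> h X <= gauge_norm g X.
Proof.
have [U [V /is_svdE[hU hV hs XE]]] := svd_exists X.
rewrite {1}XE => /(rank_synth _ hU hV hs) s0.
apply: low_rank_norm_le => W TW.
apply: le_trans (inner_mx_le_singular_values _ _) _.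
have -> : dotr (singular_values X) (singular_values W) =
          dotr (singular_values X) (trunc_row r (singular_values W)).
  apply: eq_bigr => i _; rewrite !mxE; case: ltnP => // /s0 ->.
  by rewrite !mul0r.
apply: le_trans (holder hg _ _) _; rewrite -trunc_gauge_normE.
by rewrite -[leRHS]mulr1 ler_wpM2l // gauge_ge0.
Qed.

(** The truncated dual norm is at most the dual norm, so its unit ball is
    larger and contains near-optimal witnesses of the bidual norm of [X]. *)
Lemma gauge_le_low_rank_norm (X : 'M[R]_(n, m)) : gauge_norm g X <= h X.
Proof.
have [U [V /is_svdE[hU hV hs XE]]] := svd_exists X.
rewrite leNgt; apply/negP => lt.
have [|y y1 cy] := gauge_bidual hg (x := singular_values X)
    (c := (h X + gauge_norm g X) / 2); first by rewrite -/(gauge_norm g X); lra.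
have : inner_mx X (synth U y V) <= h X.
  apply: low_rank_norm_ge; rewrite trunc_gauge_normE.
  apply: le_trans (vec_dual_mask hg _ _) _.
  have [|p hp] := @sorting_perm _ _ (normr_mx y); first by move=> i; rewrite mxE.
  have [U' [V' /singular_valuesE ->]] := synth_svd hU hV hp.
  exact: le_trans (vec_dual_sorting hg _ _) y1.
rewrite {1}XE dotr_synth //; lra.
Qed.

Lemma low_rank_norm_eq_gauge (X : 'M[R]_(n, m)) :
  (\rank X <= r)%N -> h X = gauge_norm g X.
Proof.
move=> hX; apply/eqP.
by rewrite eq_le low_rank_norm_le_gauge // gauge_le_low_rank_norm.
Qed.
End LowRankNorm.

(** Without truncation there is nothing to lose: the case [r = min(m, n)] makes
    every result on low-rank inducing norms available for [gauge_norm g]. *)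
Lemma gauge_normE (R : realType) (m n : nat) (g : 'rV[R]_(minn m n) -> R) :
  symmetric_gauge g -> (0 < minn m n)%N ->
  gauge_norm (m := m) (n := n) g = low_rank_norm g (minn m n).
Proof.
move=> hg q0; apply/funext => X; rewrite low_rank_norm_eq_gauge //.
  by rewrite q0 /=.
by rewrite leq_min rank_leq_row rank_leq_col.
Qed.

(** * Proximal mappings of spectral functions *)

Lemma synthB (R : realType) (m n q : nat) (U : 'M[R]_(n, q)) x y
    (V : 'M[R]_(m, q)) :
  synth U (x - y) V = synth U x V - synth U y V.
Proof. by rewrite /synth [diag_mx _]linearB /= mulmxBr mulmxBl. Qed.

Lemma synthZ (R : realType) (m n q : nat) a (U : 'M[R]_(n, q)) x
    (V : 'M[R]_(m, q)) :
  synth U (a *: x) V = a *: synth U x V.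
Proof. by rewrite /synth [diag_mx _]linearZ /= -scalemxAr -scalemxAl. Qed.

(** Aligning the singular vectors of [X] with those of [Z] keeps the norm of [X]
    and, by von Neumann, does not decrease its pairing with [Z]. *)
Lemma half_sqdist_svd_le (R : realType) (m n : nat) (Z : 'M[R]_(n, m)) U z V X :
  is_svd Z U z V ->
  half_sqdist Z (synth U (singular_values X) V) <= half_sqdist Z X.
Proof.
move=> svdZ; have /is_svdE[hU hV hz ZE] := svdZ.
set X' := synth _ _ _.
have XX : inner_mx X' X' = inner_mx X X.
  by rewrite /X' dotr_synth // -inner_mx_singular_values.
have XZ : inner_mx X Z <= inner_mx X' Z.
  rewrite [in leRHS]ZE /X' dotr_synth // -(singular_valuesE svdZ).
  exact: inner_mx_le_singular_values.
rewrite /half_sqdist !inner_mxl XX (inner_mxC Z X') (inner_mxC Z X); lra.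
Qed.

Section SpectralProx.
Context (R : realType) (m n : nat) (N : 'M[R]_(n, m) -> R) (k : R -> \bar R).
Hypotheses (hN : seminorm N) (hk : convex_cost k).
Hypothesis N_spectral :
  forall X Y, singular_values X = singular_values Y -> N X = N Y.
Context (Z M : 'M[R]_(n, m)) (U : 'M[R]_(n, minn m n)) (z : 'rV[R]_(minn m n))
  (V : 'M[R]_(m, minn m n)).
Hypotheses (svdZ : is_svd Z U z V) (proxM : prox (fun X => k (N X)) Z M).

Let x := singular_values M.

(** The minimizer has the singular vectors of [Z], because aligning them yields
    another minimizer and there is only one. *)
Lemma prox_spectral : M = synth U x V.
Proof.
have /is_svdE[hU hV hz ZE] := svdZ.
apply: (prox_unique hN hk proxM) => Y; apply: le_trans (proxM Y).
rewrite (_ : N (synth U x V) = N M); last first.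
  apply: N_spectral; rewrite singular_values_synth //.
  exact: sorted_singular_values.
rewrite leeD2l // lee_fin !sqr_frob_norm.
exact: half_sqdist_svd_le svdZ.
Qed.

(** Signed permutations of [x] are competitors with the same value of [N]. *)
Lemma prox_spectral_variational (p : 'S_(minn m n)) (x' : 'rV[R]_(minn m n)) :
  col_perm p (normr_mx x') = x -> dotr (z - x) (x' - x) <= 0.
Proof.
have /is_svdE[hU hV hz ZE] := svdZ; move=> x'E.
have hx : sorted_nneg x by exact: sorted_singular_values.
rewrite -(dotr_synth _ _ hU hV) !synthB -ZE -prox_spectral.
apply: (prox_variational hN hk proxM).
rewrite (_ : N (synth U x' V) = N M) //; apply: N_spectral.
have [|U' [V' /singular_valuesE ->]] := @synth_svd _ _ _ U x' V p hU hV.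
  by rewrite x'E.
exact: x'E.
Qed.

(** Flipping the sign of [x_i] yields [z_i >= x_i] when [x_i > 0], and swapping
    [x_i] with [x_j] yields [z_i - x_i >= z_j - x_j] when [x_i > x_j]; in the
    remaining cases the claim is inherited from [z]. *)
Lemma prox_residual_sorted : sorted_nneg (z - x).
Proof.
have /is_svdE[hU hV [z0 zle] ZE] := svdZ.
have [x0 xle] : sorted_nneg x by exact: sorted_singular_values.
split=> [i|i j ij]; rewrite !mxE.
  have [xi|xi] := leP (x 0 i) 0; first by have := z0 i; lra.
  have := @prox_spectral_variational 1%g (signflip (pred1 i) x).
  have -> : dotr (z - x) (signflip (pred1 i) x - x) =
            (z 0 i - x 0 i) * (- 2 * x 0 i).
    rewrite /dotr (bigD1 i) //= big1 => [|j /negbTE ji]; rewrite !mxE /= ?eqxx.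
      by rewrite addr0; ring.
    by rewrite ji subrr mulr0.
  have h : col_perm 1%g (normr_mx (signflip (pred1 i) x)) = x.
    apply/rowP => j; rewrite !mxE perm1; case: ifP => _; rewrite ?normrN ger0_norm //.
  by move=> /(_ h); nra.
have [xij|xij] := leP (x 0 i) (x 0 j); first by have := zle _ _ ij; lra.
have ji : j != i by apply: contraTneq xij => ->; rewrite ltxx.
have := @prox_spectral_variational (tperm i j) (col_perm (tperm i j) x).
have -> : dotr (z - x) (col_perm (tperm i j) x - x) =
          (z 0 i - x 0 i) * (x 0 j - x 0 i) + (z 0 j - x 0 j) * (x 0 i - x 0 j).
  rewrite /dotr (bigD1 i) //= (bigD1 j) //= big1 => [|l /andP[li lj]].
    by rewrite addr0 !mxE tpermL tpermR.
  by rewrite !mxE tpermD 1?eq_sym // subrr mulr0.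
have h : col_perm (tperm i j) (normr_mx (col_perm (tperm i j) x)) = x.
  by apply/rowP => l; rewrite !mxE tpermK ger0_norm.
by move=> /(_ h); nra.
Qed.
End SpectralProx.

Lemma convex_costZ (R : realType) (k : R -> \bar R) (c : R) :
  0 < c -> convex_cost k -> convex_cost (fun t => (c%:E * k t)%E).
Proof.
move=> c0 [[kNy [x0 x00 kx0]] kcl kmono kconv].
have c0' : (0 <= c%:E)%E by rewrite lee_fin ltW.
split.
- split=> [x hx|]; last by exists x0 => //; rewrite fin_numM.
  have := kNy x hx; case: (k x) => // _; rewrite gt0_muley //.
- move=> a; rewrite (_ : [set _ | _] = [set x : R | 0 <= x /\ (k x <= (a / c)%:E)%E]).
    exact: kcl.
  apply/seteqP; split=> x /= [hx h]; split=> //; move: h (kNy x hx).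
    case: (k x) => [t| |] //; first by rewrite -EFinM !lee_fin ler_pdivlMr // mulrC.
    by rewrite gt0_muley.
  case: (k x) => [t| |] //.
  by rewrite -EFinM !lee_fin ler_pdivlMr // mulrC.
- by move=> x y hx xy; apply: lee_wpmul2l => //; apply: kmono.
move=> x y t hx hy ht0 ht1.
apply: le_trans (lee_wpmul2l c0' (kconv x y t hx hy ht0 ht1)) _.
have Ny u v : 0 <= u -> 0 <= v -> (u%:E * k v)%E \in [pred x : \bar R | (-oo < x)%E].
  move=> u0 v0; rewrite inE ltNye; have := kNy v v0; case: (k v) => [a| |] // _.
  have [->|uN0] := eqVneq u 0; first by rewrite mul0e.
  by rewrite gt0_muley // lte_fin lt_neqAle eq_sym uN0.
rewrite muleDr //; last by apply: ltninfty_adde_def; apply: Ny => //; rewrite subr_ge0.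
by rewrite !muleA -!EFinM [c * t]mulrC [c * (1 - t)]mulrC.
Qed.

(** * The rank-constrained proximal mapping *)

Section RankConstrainedProx.
Context (R : realType) (m n r : nat).
Hypothesis hr : (1 <= r <= minn m n)%N.
Local Notation q := (minn m n).

Lemma sigmaE (X : 'M[R]_(n, m)) (i : 'I_q) :
  sigma i.+1 X = singular_values X 0 i.
Proof. by rewrite /sigma /= valK. Qed.

Lemma sorted_trunc_row (s : 'rV[R]_q) : sorted_nneg s -> sorted_nneg (trunc_row r s).
Proof.
move=> [s0 sle]; split=> [i|i j ij]; rewrite !mxE; first by case: ifP.
case: ifP => jr; last by case: ifP.
by rewrite (leq_ltn_trans ij jr) sle.
Qed.

Lemma svd_r_synth (Z P : 'M[R]_(n, m)) : svd_r r Z P ->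
  exists U s V, is_svd Z U s V /\ P = synth U (trunc_row r s) V.
Proof.
move=> [U [s [V [svdZ ->]]]]; exists U, s, V; split=> //.
rewrite synthE big_mkcond /=; apply: eq_bigr => i _; rewrite mxE.
by case: ifP => // _; rewrite scale0r.
Qed.

(** Pythagoras: the tail of [s] beyond the first [r] entries is orthogonal to
    [x] and to the head of [s]. *)
Lemma half_sqdist_trunc_row (U : 'M[R]_(n, q)) (V : 'M[R]_(m, q)) (s x : 'rV[R]_q) :
  U^T *m U = 1%:M -> V^T *m V = 1%:M ->
  (forall i : 'I_q, (r <= i)%N -> x 0 i = 0) ->
  half_sqdist (synth U s V) (synth U x V) =
  half_sqdist (synth U (trunc_row r s) V) (synth U x V) +
  2^-1 * dotr (s - trunc_row r s) (s - trunc_row r s).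
Proof.
move=> hU hV x0; rewrite /half_sqdist -!synthB !dotr_synth // -mulrDr.
congr (_ * _); rewrite /dotr -big_split; apply: eq_bigr => i _ /=.
rewrite !mxE; case: ltnP => [ir|/x0 ->]; ring.
Qed.

Context (g : 'rV[R]_q -> R) (k : R -> \bar R) (gamma : R).
Hypotheses (hg : symmetric_gauge g) (hk : convex_cost k) (hgamma : 0 < gamma).

Local Notation gn := (gauge_norm (m := m) (n := n) g).
Local Notation h := (low_rank_norm (m := m) (n := n) g r).
Local Notation kap := (fun t => (gamma%:E * k t)%E).
Local Notation F1 := (fun M : 'M[R]_(n, m) =>
  (gamma%:E * (k (gauge_norm g M) + rank_indicator r M))%E).

Let hkap : convex_cost kap. Proof. exact: convex_costZ. Qed.

Let q0 : (0 < q)%N. Proof. by case/andP: hr; apply: leq_trans. Qed.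

Let gn_seminorm : seminorm gn.
Proof. by rewrite gauge_normE //; apply: low_rank_norm_seminorm; rewrite // q0 /=. Qed.

Let gn_spectral (X Y : 'M[R]_(n, m)) :
  singular_values X = singular_values Y -> gn X = gn Y.
Proof. by rewrite /gauge_norm => ->. Qed.

Let h_seminorm : seminorm h. Proof. exact: low_rank_norm_seminorm. Qed.

Let h_spectral (X Y : 'M[R]_(n, m)) :
  singular_values X = singular_values Y -> h X = h Y.
Proof. exact: low_rank_norm_spectral. Qed.

(** On matrices of rank at most [r] both norms agree, so the rank-constrained
    objective may be expressed with either. *)
Lemma rank_constrainedE X :
  F1 X = if (\rank X <= r)%N then kap (h X) else +oo%E.
Proof.
rewrite /rank_indicator; case: ifP => rX.
  by rewrite adde0 low_rank_norm_eq_gauge.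
have kNy : k (gauge_norm g X) != -oo%E.
  by apply: (cost_proper hk).1; apply: seminorm_ge0.
by rewrite addey // gt0_muley.
Qed.

Lemma rank_constrained_proxP Z M : prox F1 Z M <->
  exists2 t, F1 M = t%:E & forall X s, F1 X = s%:E ->
    t + half_sqdist Z M <= s + half_sqdist Z X.
Proof.
apply: prox_finP => [X|].
  rewrite rank_constrainedE; case: ifP => // _.
  by apply: (cost_proper hkap).1; apply: seminorm_ge0.
exists 0; rewrite rank_constrainedE mxrank0 leq0n (seminorm0 h_seminorm).
exact: cost_fin0 hkap.
Qed.

Lemma prox_set1 (N : 'M[R]_(n, m) -> R) Z M : seminorm N ->
  prox (fun X => kap (N X)) Z M -> prox (fun X => kap (N X)) Z = [set M].
Proof.
move=> hN hM; apply/seteqP; split=> [M' hM'|_ ->] //.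
exact: (prox_unique hN hkap hM' hM).
Qed.

(** The minimizer [M] of the unconstrained problem at [P] has singular values
    between 0 and those of [P], hence rank at most [r]. There the two norms
    agree, while [h] dominates the gauge norm elsewhere; so [M] also minimizes
    the problem for [h]. For the constrained problem at [Z], a competitor may be
    aligned with [Z], and then [half_sqdist_trunc_row] turns distances to [Z]
    into distances to [P] up to a common constant. *)
Lemma prox_truncation Z P : svd_r r Z P -> exists M,
  [/\ prox (fun X => kap (gn X)) P = [set M],
      prox (fun X => kap (h X)) P = [set M] & prox F1 Z M].
Proof.
move=> /svd_r_synth[U [s [V [svdZ PE]]]].
have /is_svdE[hU hV hs ZE] := svdZ.
have svdP : is_svd P U (trunc_row r s) V.
  by apply/is_svdE; split=> //; apply: sorted_trunc_row.
have [M hM] := prox_exists P gn_seminorm hkap.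
have ME := prox_spectral gn_seminorm hkap gn_spectral svdP hM.
have [res0 _] := prox_residual_sorted gn_seminorm hkap gn_spectral svdP hM.
have hx := sorted_singular_values M; set x := singular_values M in ME res0 hx.
have x0 (i : 'I_q) : (r <= i)%N -> x 0 i = 0.
  move=> ri; apply/eqP; rewrite eq_le hx.1 andbT.
  by have := res0 i; rewrite !mxE ltnNge ri /= sub0r oppr_ge0.
have rM : (\rank M <= r)%N by rewrite ME; apply/rank_synth.
have hME : h M = gn M by apply: low_rank_norm_eq_gauge.
exists M; split; first exact: prox_set1.
  apply: prox_set1 => // X; rewrite hME; apply: le_trans (hM X) _.
  rewrite leeD2r //; apply: (cost_mono hkap); first exact: seminorm_ge0.
  exact: gauge_le_low_rank_norm.
have /(prox_seminormP _ gn_seminorm hkap)[t tM minM] := hM.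
apply/rank_constrained_proxP; exists t.
  by rewrite rank_constrainedE rM hME.
move=> X v; rewrite rank_constrainedE; case: ifP => // rX.
rewrite low_rank_norm_eq_gauge // => vX.
have [U' [V' /is_svdE[hU' hV' hX XE]]] := svd_exists X.
apply: (@le_trans _ _ (v + half_sqdist Z (synth U (singular_values X) V))); last first.
  by rewrite lerD2l; apply: half_sqdist_svd_le svdZ.
have dist (w : 'rV[R]_q) : (forall i : 'I_q, (r <= i)%N -> w 0 i = 0) ->
    half_sqdist Z (synth U w V) =
    half_sqdist P (synth U w V) + 2^-1 * dotr (s - trunc_row r s) (s - trunc_row r s).
  by move=> w0; rewrite ZE PE; apply: half_sqdist_trunc_row.
have xX0 : forall i : 'I_q, (r <= i)%N -> singular_values X 0 i = 0.
  by apply/(rank_synth _ hU' hV' hX); rewrite -XE.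
have distM := dist _ x0; rewrite -ME in distM.
rewrite distM (dist _ xX0) !addrA lerD2r; apply: minM.
by rewrite (gn_spectral (singular_values_synth hU hV hX)).
Qed.

Section RankEquivalence.
Context (Z Mc : 'M[R]_(n, m)).
Hypothesis hMc : prox (fun X => kap (h X)) Z Mc.

(** The rank-constrained objective is at least the one with [h], with equality
    when the rank is at most [r], and is infinite otherwise. *)
Lemma prox_rank_constrained_iff : prox F1 Z = [set Mc] <-> (\rank Mc <= r)%N.
Proof.
have /(prox_seminormP _ h_seminorm hkap)[t tM minM] := hMc.
have F1h X s : F1 X = s%:E -> (\rank X <= r)%N /\ kap (h X) = s%:E.
  by rewrite rank_constrainedE; case: ifP.
split=> [F1E|rM].
  have /rank_constrained_proxP[s /F1h[]] // : prox F1 Z Mc by rewrite F1E.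
have F1M : F1 Mc = t%:E by rewrite rank_constrainedE rM.
apply/seteqP; split=> [M' /rank_constrained_proxP[s /F1h[_ sM'] min']|_ ->].
  apply: (prox_unique h_seminorm hkap _ hMc).
  apply/(prox_seminormP _ h_seminorm hkap); exists s => // X v vX.
  exact: le_trans (min' _ _ F1M) (minM _ _ vX).
apply/rank_constrained_proxP; exists t => // X v /F1h[_]; exact: minM.
Qed.

(** The case of equality in [low_rank_norm_holder] for [Z - Mc] and [Mc]. On the
    ball of radius [h Mc] the pairing with [Z - Mc] is maximal at [Mc]. The
    vectors [w] that compute the dual gauge of the head of the singular values of
    [Z - Mc] provide test matrices of rank at most [r] in that ball. *)
Lemma prox_holder_eq :
  h Mc * trunc_gauge_norm (gauge_dual (m := m) (n := n) g) r (Z - Mc) <=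
  inner_mx (Z - Mc) Mc.
Proof.
set Y := Z - Mc.
have var X : h X <= h Mc -> inner_mx Y X <= inner_mx Y Mc.
  move=> hX; rewrite -subr_le0 -inner_mxNr -inner_mxDr.
  apply: (prox_variational h_seminorm hkap hMc); apply: (cost_mono hkap) => //.
  exact: seminorm_ge0.
have hM0 : 0 <= h Mc by apply: seminorm_ge0.
have [U [V /is_svdE[hU hV hy YE]]] := svd_exists Y.
have test w : g w <= 1 ->
    h Mc * dotr w (trunc_row r (singular_values Y)) <= inner_mx Y Mc.
  move=> gw; rewrite dotr_mask dotrC -dotrZr -(dotr_synth _ _ hU hV) -YE.
  apply: var; rewrite synthZ (seminormZ h_seminorm) ger0_norm //.
  rewrite -[leRHS]mulr1; apply: ler_wpM2l => //.
  rewrite low_rank_norm_eq_gauge //.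
    rewrite /gauge_norm gauge_singular_values_synth //.
    exact: le_trans (gauge_mask hg _ _) gw.
  by apply: rank_synth_le => i ri; rewrite mxE ltnNge ri.
rewrite trunc_gauge_normE //.
have [h0|hN0] := eqVneq (h Mc) 0.
  by rewrite h0 mul0r; have := test 0; rewrite h0 mul0r gauge0 // => ->.
have hgt0 : 0 < h Mc by rewrite lt_neqAle eq_sym hN0.
rewrite mulrC -ler_pdivlMr //; apply: vec_dual_le => // w gw.
by rewrite ler_pdivlMr // mulrC test.
Qed.

Let svd_residual : exists U V,
  [/\ is_svd Z U (singular_values Z) V,
      Mc = synth U (singular_values Mc) V &
      is_svd (Z - Mc) U (singular_values Z - singular_values Mc) V].
Proof.
have [U [V svdZ]] := svd_exists Z; exists U, V.
have ME := prox_spectral h_seminorm hkap h_spectral svdZ hMc.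
have hy := prox_residual_sorted h_seminorm hkap h_spectral svdZ hMc.
have /is_svdE[hU hV hz ZE] := svdZ.
by split=> //; apply/is_svdE; split=> //; rewrite synthB -ZE -ME.
Qed.

Lemma prox_residual_singular_values :
  singular_values (Z - Mc) = singular_values Z - singular_values Mc.
Proof. by have [U [V [_ _ /singular_valuesE]]] := svd_residual. Qed.

Lemma prox_rankE :
  (\rank Mc <= r)%N <->
  (forall i : 'I_q, (r <= i)%N -> singular_values Mc 0 i = 0).
Proof.
have [U [V [/is_svdE[hU hV _ _] ME _]]] := svd_residual.
by rewrite {1}ME; apply (rank_synth r hU hV (sorted_singular_values Mc)).
Qed.

(** Let [x] and [y] be the singular values of [Mc] and [Z - Mc]. Raising the
    entries of [y] from the index [r] on to the level of the [r]-th singular value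
    leaves the truncated dual norm of the residual unchanged, but would increase
    its pairing with [Mc] if [x_i > 0]: by assumption [y_i = z_i - x_i] is then
    strictly below that level. This contradicts equality in Hoelder. *)
Lemma prox_tail_eq0 (i : 'I_q) :
  sigma r.+1 Z <= sigma r (Z - Mc) -> (r <= i)%N -> singular_values Mc 0 i = 0.
Proof.
have [U [V [/is_svdE[hU hV hz ZE] ME svdY]]] := svd_residual.
have /is_svdE[_ _ hy YE] := svdY.
have hx := sorted_singular_values Mc.
set x := singular_values Mc in ME svdY hy YE hx *.
set z := singular_values Z in ZE svdY hz hy YE *.
have [r1 rq] := andP hr; have rq1 : (r.-1 < q)%N by rewrite prednK.
move=> sle ri; have rq' : (r < q)%N := leq_ltn_trans ri (ltn_ord i).
pose l : 'I_q := Ordinal rq1; set y := z - x in svdY hy YE.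
have sr : sigma r (Z - Mc) = y 0 l.
  by rewrite -(singular_valuesE svdY) -sigmaE /= prednK.
rewrite sr (sigmaE Z (Ordinal rq')) -/z in sle.
apply/eqP; apply: contraT => xiN0; exfalso.
have xi : 0 < x 0 i by rewrite lt_neqAle eq_sym xiN0 hx.1.
have yi : y 0 i < y 0 l.
  apply: lt_le_trans sle; apply: (@lt_le_trans _ _ (z 0 i)).
    by rewrite !mxE ltrBlDr ltrDl.
  exact: hz.2.
(* y raised to the level of the r-th singular value, which has index l *)
pose y' : 'rV[R]_q := \row_j (if (j < r)%N then y 0 j else y 0 l).
have yy' (j : 'I_q) : y 0 j <= y' 0 j.
  rewrite [y' 0 j]mxE; case: ltnP => // rj; apply: hy.2.
  by apply: leq_trans (leq_pred r) rj.
have hy' : sorted_nneg y'.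
  split=> [j|j j' jj']; first exact: le_trans (hy.1 j) (yy' j).
  rewrite [y' 0 j']mxE [y' 0 j]mxE; case: (ltnP j' r) => j'r.
    by rewrite (leq_ltn_trans jj' j'r) hy.2.
  by case: ltnP => // jr; apply: hy.2; rewrite /= -ltnS prednK.
pose Y' := synth U y' V.
have TY : trunc_gauge_norm (gauge_dual (m := m) (n := n) g) r Y' =
          trunc_gauge_norm (gauge_dual (m := m) (n := n) g) r (Z - Mc).
  rewrite !trunc_gauge_normE // (singular_valuesE svdY) singular_values_synth //.
  by congr vec_dual; apply/rowP => j; rewrite !mxE; case: (j < r)%N.
have le : inner_mx Mc Y' <= inner_mx (Z - Mc) Mc.
  apply: le_trans (low_rank_norm_holder hg hr Mc Y') _; rewrite TY.
  exact: prox_holder_eq.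
have e1 : inner_mx Mc Y' = dotr y' x by rewrite {1}ME inner_mxC dotr_synth.
have e2 : inner_mx (Z - Mc) Mc = dotr y x by rewrite {2}ME YE dotr_synth.
have lt : dotr y x < dotr y' x.
  apply: ltr_dotr hx.1 yy' xi _.
  by rewrite [y' 0 i]mxE ltnNge ri.
by move: le; rewrite e1 e2 leNgt lt.
Qed.

Lemma prox_rank_equivalence :
  [<-> prox F1 Z = [set Mc];
       (\rank Mc <= r)%N;
       forall j : nat, (1 <= j <= q - r)%N -> sigma (r + j) (Z - Mc) = sigma (r + j) Z;
       sigma r.+1 Z <= sigma r (Z - Mc)].
Proof.
have [r1 rq] := andP hr.
tfae.
- by move/prox_rank_constrained_iff.
- move/prox_rankE => x0 [//|j] /= jq; rewrite addnS.
  have rjq : (r + j < q)%N by lia.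
  rewrite !(sigmaE _ (Ordinal rjq)) prox_residual_singular_values.
  by rewrite 2!mxE x0 ?subr0 //= leq_addr.
- move=> H; have [U [V [_ _ /is_svdE[_ _ hy _]]]] := svd_residual.
  have rq1 : (r.-1 < q)%N by rewrite prednK.
  have sr (X : 'M[R]_(n, m)) : sigma r X = singular_values X 0 (Ordinal rq1).
    by rewrite -sigmaE /= prednK.
  have [qr|rq'] := leqP q r.
    have -> : sigma r.+1 Z = 0 by rewrite /sigma /= insubF // ltnNge qr.
    by rewrite sr; apply: (sorted_singular_values _).1.
  have h1 : (1 <= 1 <= q - r)%N by lia.
  have := H 1%N h1; rewrite addn1 => <-.
  rewrite sr (sigmaE _ (Ordinal rq')).
  by apply: (sorted_singular_values _).2; rewrite /= leq_pred.
move=> H; apply/prox_rank_constrained_iff/prox_rankE => i.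
exact: prox_tail_eq0.
Qed.
End RankEquivalence.
End RankConstrainedProx.

Theorem theorem1 (R : realType) (m n r : nat) (hr : (1 <= r <= minn m n)%N)
    (Z : 'M[R]_(n, m)) (gamma : R) (hgamma : 0 < gamma)
    (g : 'rV[R]_(minn m n) -> R) (hg : symmetric_gauge g)
    (k : R -> \bar R) (hk_proper : nneg_proper k) (hk_closed : nneg_closed k)
    (hk_incr : nneg_increasing k) (hk_convex : nneg_convex k) :
  let f1 := fun M : 'M[R]_(n, m) =>
    (k (gauge_norm g M) + rank_indicator r M)%E in
  let prox_g := prox (fun M : 'M[R]_(n, m) =>
    (gamma%:E * k (gauge_norm g M))%E) in
  let prox_gr := prox (fun M : 'M[R]_(n, m) =>
    (gamma%:E * k (low_rank_norm g r M))%E) in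
  let prox_f1 := prox (fun M : 'M[R]_(n, m) => (gamma%:E * f1 M)%E) in
  (forall P : 'M[R]_(n, m), svd_r r Z P ->
     exists M : 'M[R]_(n, m),
       [/\ prox_g P = [set M], prox_gr P = [set M] & prox_f1 Z M]) /\
  (exists Mc : 'M[R]_(n, m), prox_gr Z = [set Mc] /\
     [<-> prox_f1 Z = [set Mc];
          (\rank Mc <= r)%N;
          forall j : nat, (1 <= j <= minn m n - r)%N ->
            sigma (r + j) (Z - Mc) = sigma (r + j) Z;
          sigma r.+1 Z <= sigma r (Z - Mc)]).
Proof.
move=> f1 prox_g prox_gr prox_f1.
have hk : convex_cost k by split=> //; case: hk_incr.
split=> [P ZP|]; first exact: prox_truncation hr _ _ _ hg hk hgamma _ _ ZP.
have hN := low_rank_norm_seminorm hg hr.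
have [Mc hMc] := prox_exists Z hN (convex_costZ hgamma hk).
exists Mc; split; first exact: prox_set1.
exact: prox_rank_equivalence.
Qed.
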